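(* The lattice $\mathcal{M}_{\mathcal{C}}$ (defined in the context) is an even positive-definite lattice of rank $85$, with discriminant $2^{20}$, and of minimal norm $8$.
   Context: Let $\mathcal{P}_0=\mathbb{P}^3(\mathbb{F}_4)$ be the set of $\mathbb{F}_4$-rational points of projective $3$-space ($85$ points). For $k=1,2,3$, let $\mathcal{P}_{k-1}$ be the set of subsets $S\subset\mathcal{P}_0$ of the form: the set of $\mathbb{F}_4$-points of a $(k-1)$-dimensional $\mathbb{F}_4$-rational projective linear subspace (points, lines, planes; a one-point subset is identified with its point). Let $\mathcal{M}^\vee=\bigoplus_{P\in\mathcal{P}_0}\mathbb{Z}e_P\cong\mathbb{Z}^{85}$, with the $\mathbb{Q}$-valued symmetric bilinear form $(e_P,e_P)=1/4$ and $(e_P,e_{P'})=0$ for $P\ne P'$. For $S\subset\mathcal{P}_0$ put $v_S=\sum_{P\in S}e_P$. Let $\mathcal{N}_\Sigma\subset\mathcal{M}^\vee$ be the submodule generated by the vectors $2^{3-k}(v_S-v_{S'})$ for $S,S'\in\mathcal{P}_{k-1}$, $k=1,2,3$. Let $\mathcal{C}\subset\mathcal{M}^\vee\otimes\mathbb{Z}/8\mathbb{Z}\cong(\mathbb{Z}/8\mathbb{Z})^{85}$ be the image of $\mathcal{N}_\Sigma$ under reduction modulo $8$, and let $\mathcal{M}_{\mathcal{C}}\subset\mathcal{M}^\vee$ be the inverse image of $\mathcal{C}$ under the reduction map; thus $\mathcal{M}_{\mathcal{C}}=\mathcal{N}_\Sigma+8\mathcal{M}^\vee$. The bilinear form of $\mathcal{M}^\vee$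 takes integer values on $\mathcal{M}_{\mathcal{C}}$, so $\mathcal{M}_{\mathcal{C}}$ is a lattice. The norm of a vector $x$ is $(x,x)$; the minimal norm is the minimum of the norms of the non-zero vectors; the discriminant is the determinant of a Gram matrix; a lattice is even if all norms are even. (Geometric origin: $\mathcal{M}^\vee$ is the dual lattice of the lattice $\mathcal{M}$ generated by the classes $[\Sigma_{\ell}]$, for $\ell$ the $1$-dimensional $\mathbb{F}_4$-rational subspaces, on the Frobenius incidence variety $\sum_{i=1}^4 x_i^2y_i=\sum_{i=1}^4 x_iy_i^2=0$ in characteristic $2$, and $\mathcal{N}_\Sigma$ is the lattice generated by the differences $[\Sigma_\Lambda]-[\Sigma_{\Lambda'}]$, $\dim\Lambda=\dim\Lambda'$, where for an $\mathbb{F}_4$-rational subspace $\Lambda$ the cycle $\Sigma_\Lambda$ consists of the pairs $(L,M)$ of a $1$-dimensional subspace and a hyperplane with $L\subset\Lambda$ and $\Lambda^2\subset M$.) *)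

(* Defs.v *)
From HB Require Import structures.
From mathcomp Require Import all_boot all_order all_algebra.
Set Implicit Arguments.
Unset Strict Implicit.
Unset Printing Implicit Defensive.
Import Order.TTheory GRing.Theory Num.Theory.
Local Open Scope ring_scope.

Section Lattices.
Variable V : zmodType.

Definition int_submodule (L : V -> Prop) : Prop :=
  L 0 /\ forall x y, L x -> L y -> L (x - y).

Definition generated_submodule (G : V -> Prop) (x : V) : Prop :=
  exists m (s : m.-tuple V), (forall i, G (tnth s i)) /\ inIntSpan s x.

Definition int_basis (L : V -> Prop) n (s : n.-tuple V) : Prop :=
  (forall x, L x <-> inIntSpan s x) /\
  (forall a : 'I_n -> int,
     \sum_(i < n) tnth s i *~ a i = 0 -> forall i, a i = 0).

Definition has_rank (L : V -> Prop) (n : nat) : Prop :=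
  exists s : n.-tuple V, int_basis L s.

Variable f : V -> V -> rat.

(* The form is given on the ambient group V; its properties are required on
   the submodule L only. *)
Record is_lattice (L : V -> Prop) : Prop := IsLattice {
  lattice_submodule : int_submodule L;
  lattice_free : exists n, has_rank L n;
  lattice_symmetric : forall x y, L x -> L y -> f x y = f y x;
  lattice_additive :
    forall x y z, L x -> L y -> L z -> f (x + y) z = f x z + f y z;
  lattice_integral : forall x y, L x -> L y -> f x y \is a Num.int;
  lattice_nondegenerate :
    forall x, L x -> (forall y, L y -> f x y = 0) -> x = 0
}.

Definition is_even (L : V -> Prop) : Prop :=
  forall x, L x -> exists m : int, f x x = (2 * m)%:~R.

Definition positive_definite (L : V -> Prop) : Prop :=
  forall x, L x -> x != 0 -> 0 < f x x.

Definition gram n (s : n.-tuple V) : 'M[rat]_n :=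
  \matrix_(i, j) f (tnth s i) (tnth s j).

Definition has_discriminant (L : V -> Prop) (d : rat) : Prop :=
  (exists n (s : n.-tuple V), int_basis L s) /\
  (forall n (s : n.-tuple V), int_basis L s -> \det (gram s) = d).

Definition has_minimal_norm (L : V -> Prop) (m : rat) : Prop :=
  (exists x, [/\ L x, x != 0 & f x x = m]) /\
  (forall x, L x -> x != 0 -> m <= f x x).

End Lattices.

Section Geometry.
Variable F : finFieldType.

(* A point of P^3(F) is a line of F^4, encoded by the canonical matrix
   <<A>>%MS of rank 1 whose row space is that line. *)
Definition proj_point : Type :=
  {A : 'M[F]_4 | (<<A>>%MS == A) && (\rank A == 1%N)}.
HB.instance Definition _ := Finite.on proj_point.

Definition linear_set (U : 'M[F]_4) : {set proj_point} :=
  [set P : proj_point | (val P <= U)%MS].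

(* The sets of F-points of the (k-1)-dimensional projective subspaces. *)
Definition subspaces (k : nat) : {set {set proj_point}} :=
  [set linear_set U | U : 'M[F]_4 & \rank U == k].

Local Notation Mdual := {ffun proj_point -> int}.

Definition basis_vector (P : proj_point) : Mdual :=
  [ffun Q => (Q == P)%:Z].

(* The symmetric bilinear form with (e_P, e_P) = 1/4, the e_P orthogonal. *)
Definition dual_form (x y : Mdual) : rat :=
  \sum_(P : proj_point) (x P)%:~R * (y P)%:~R / 4.

Definition set_vector (S : {set proj_point}) : Mdual :=
  \sum_(P in S) basis_vector P.

Definition N_generator (x : Mdual) : Prop :=
  exists (k : nat) (S S' : {set proj_point}),
    [/\ (1 <= k <= 3)%N, S \in subspaces k, S' \in subspaces k
      & x = (set_vector S - set_vector S') *+ 2 ^ (3 - k)].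

Definition N_Sigma : Mdual -> Prop := generated_submodule N_generator.

Definition reduce8 (x : Mdual) : {ffun proj_point -> 'Z_8} :=
  [ffun P => (x P)%:~R].

Definition code_C (c : {ffun proj_point -> 'Z_8}) : Prop :=
  exists2 y, N_Sigma y & c = reduce8 y.

Definition M_C (x : Mdual) : Prop := code_C (reduce8 x).

End Geometry.

(* Main.v *)
From HB Require Import structures.
Require Import Defs.
From mathcomp Require Import all_boot all_order all_algebra.
From mathcomp Require Import all_field all_character.
From mathcomp Require Import zify ring.

Set Implicit Arguments.
Unset Strict Implicit.
Unset Printing Implicit Defensive.
Import Order.TTheory GRing.Theory Num.Theory.
Local Open Scope ring_scope.

(** Write [L] for the lattice, a subgroup of the functions from the 85 points
    to the integers; its norm is a quarter of the sum of the squares of the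
    coordinates.

    _Integrality and evenness._  The generators are combinations of indicators
    of subspaces, and the number of points of an intersection of subspaces is
    [(4 ^ r - 1) / 3]; congruences modulo 4 between these numbers and the powers
    of 2 in the generators give all divisibilities.

    _Discriminant._  Since [L] contains the multiples of 8, a Smith normal form
    gives a basis of the group of integer functions whose multiples by certain
    powers [2 ^ e_j], [e_j <= 3], form a basis of [L].  The number of [j] with
    [e_j <= k] is the dimension of the span of the reductions modulo 2 of the
    [x] such that [2 ^ k x] lies in [L] ([rank_filtration]).  For [k = 0, 1, 2]
    this span is that of the differences of indicators of planes, of lines and
    of points.  For [k = 1] this needs an argument: if a sum of indicators of
    planes is even, its half is congruent modulo 2 to the sum, over the pairs
    of planes, of the indicators of their intersections, since half of an even
    number [c] has the parity of the binomial coefficient [c] choose 2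
    ([half_reduction_M_C]).

    The three dimensions, over the field with four elements, are 16, 60 and 84.
    The point is that a linear form [s] is non-zero exactly where [s ^ 3 = 1]:
    the differences of planes span the cubes of the linear forms, and the
    differences of lines the products of two cubes.  Because squaring is
    additive, expanding such products and extracting coefficients shows that
    they span the same functions as the monomials [x_i x_j ^ 2] and their
    products by pairs ([rank_norm_span]); it remains to count the distinct
    monomials, reduced by [x ^ 4 = x].  Hence the sum of the [e_j] is
    [3 * 85 - (16 + 60 + 84) = 95], and the discriminant is
    [(2 ^ 95) ^ 2 / 4 ^ 85].

    _Minimal norm._  Let [x] be a non-zero element of [L]; the claim is that the
    sum of its squares is at least 32.  If [x] has odd coordinates, their
    positions are the non-zeros of a Hermitian form in four variables, and
    there are at least 32 of them ([hermitian_weight]).  If [x = 2 y] and [y] has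
    odd coordinates, their positions form a combination of lines modulo 2, of
    even cardinality.  As cubic forms sum to zero on every line, they also sum
    to zero on this set; products of three linear forms then show that it has at
    least 8 points ([cubic_relation_card]).  If [x = 4 z], the sum of the
    coordinates of [z] is even, so the sum of their squares is at least 2. *)

(** * The field with four elements *)

Section FourElements.
Variables (F : finFieldType) (hF : #|F| = 4%N).

Lemma pchar2 : 2%N \in [pchar F].
Proof. exact: (@card_finPcharP _ 2 2). Qed.

Lemma addf_self (x : F) : x + x = 0.
Proof. by rewrite -mulr2n mulrn_pchar // pchar2. Qed.

Lemma oppf_self (x : F) : - x = x.
Proof. by apply/eqP; rewrite eq_sym -addr_eq0 addf_self. Qed.

Lemma expf4 (a : F) : a ^+ 4 = a.
Proof. by rewrite -hF expf_card. Qed.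

Lemma expf3 (a : F) : a ^+ 3 = (a != 0)%:R.
Proof.
have [->|a0] := eqVneq a 0; first by rewrite expr0n.
by apply: (mulfI a0); rewrite -exprS expf4 mulr1.
Qed.

Lemma natf_odd n : n%:R = (odd n)%:R :> F.
Proof.
by rewrite -{1}(odd_double_half n) natrD -addnn natrD addf_self addr0.
Qed.

Lemma intf_odd (z : int) : z%:~R = (~~ (2 %| z)%Z)%:R :> F.
Proof.
have E (m : nat) : m%:R = (~~ (2 %| m)%N)%:R :> F.
  by rewrite natf_odd dvdn2 negbK.
by case: z => m; rewrite ?NegzE ?mulrNz ?oppf_self ?dvdzN; exact: E.
Qed.

Lemma intf_eq0 (z : int) : (z%:~R == 0 :> F) = (2 %| z)%Z.
Proof. by rewrite intf_odd; case: (2 %| z)%Z; rewrite ?eqxx ?oner_eq0. Qed.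

Lemma sumf_expr k : (k <= 2)%N -> \sum_(a : F) a ^+ k = 0.
Proof.
have [-> _|k0 k2] := posnP k.
  by under eq_bigr do rewrite expr0; rewrite sumr_const hF natf_odd.
(* Multiplication by a g with g ^+ k != 1 permutes the field and rescales the
   power sum. *)
have [g g01] : exists g : F, g \notin pred2 0 1.
  apply/existsP/contraT; rewrite negb_exists => /forallP F01.
  suff: (#|F| <= #|pred2 (0 : F)%R 1%R|)%N by rewrite hF card2; case: eqP.
  by apply/subset_leq_card/subsetP => x _; move: (F01 x); rewrite negbK.
have [g0 g1] : g != 0 /\ g != 1 by move/norP: g01.
have gk : g ^+ k != 1.
  case: k k0 k2 => [|[|[|k]]] // _ _; apply: contra_neq g1 => gk1.
  by rewrite -(mulr1 g) -[X in g * X]gk1 -exprS expf3 g0.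
have /eqP : g ^+ k * \sum_(a : F) a ^+ k = \sum_(a : F) a ^+ k.
  rewrite mulr_sumr [RHS](reindex_inj (mulfI g0)).
  by apply: eq_bigr => a _; rewrite exprMn.
rewrite -subr_eq0 -[X in _ - X]mul1r -mulrBl mulf_eq0 subr_eq0 (negPf gk).
by move/eqP.
Qed.

Lemma sumf_expr3 : \sum_(a : F) a ^+ 3 = 1.
Proof.
under eq_bigr do rewrite expf3; rewrite (bigD1 0) //= eqxx add0r.
rewrite (eq_bigr (fun=> 1)) => [|a ->] //.
by rewrite sumr_const (cardC1 0) hF natf_odd.
Qed.

(** Summing over [F] extracts the coefficient of degree 3 of a polynomial of
    degree at most 3.  For a cubic form at the points [y + a x] of a line, the
    result is its value at the last point [x], so the five values sum to zero
    in characteristic 2. *)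
Lemma sumf_cubic (A1 B1 A2 B2 A3 B3 : F) :
  \sum_(a : F) (A1 + a * B1) * (A2 + a * B2) * (A3 + a * B3) = B1 * B2 * B3.
Proof.
transitivity (\sum_(a : F) (A1 * A2 * A3 * a ^+ 0
   + (B1 * A2 * A3 + A1 * B2 * A3 + A1 * A2 * B3) * a ^+ 1
   + (B1 * B2 * A3 + B1 * A2 * B3 + A1 * B2 * B3) * a ^+ 2
   + B1 * B2 * B3 * a ^+ 3)).
  by apply: eq_bigr => a _; ring.
rewrite !big_split -!mulr_sumr /= (@sumf_expr 0) // (@sumf_expr 1) //.
by rewrite (@sumf_expr 2) // sumf_expr3; ring.
Qed.

Lemma sumf_cube (A B : F) : \sum_(a : F) (A + a * B) ^+ 3 = B ^+ 3.
Proof.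
rewrite -[RHS](_ : B * B * B = _); last by ring.
by rewrite -(sumf_cubic A B A B A B); apply: eq_bigr => a _; ring.
Qed.

Lemma expf_sub3 k (a : F) : (3 < k)%N -> a ^+ k = a ^+ (k - 3).
Proof.
move=> k3; rewrite -{1}(subnK k3) exprD expf4 -exprSr; congr (_ ^+ _); lia.
Qed.

(** The basis of the functions on [F] dual to [1, a, a^2, a^3]. *)
Definition dual_monomial (m : nat) (a : F) : F :=
  if m is 0 then (a == 0)%:R else a ^+ (3 - m).

Lemma dual_monomialP m k : (m <= 3)%N -> (k <= 3)%N ->
  \sum_(a : F) dual_monomial m a * a ^+ k = (m == k)%:R.
Proof.
move=> m3 k3; case: m m3 => [_|m m3] /=.
  rewrite (bigD1 0) //= eqxx mul1r big1 ?addr0 => [|a /negPf ->]; last exact: mul0r.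
  by rewrite expr0n eq_sym.
under eq_bigr do rewrite -exprD.
have [->|mk] := eqVneq m.+1 k; first by rewrite subnK // sumf_expr3.
have [k_lt|k_gt] := ltnP k m.+1; first by rewrite sumf_expr //; lia.
have lt3 : (3 < 3 - m.+1 + k)%N by lia.
under eq_bigr do rewrite (expf_sub3 _ lt3).
by rewrite sumf_expr //; lia.
Qed.

End FourElements.

(** * Points and subspaces of projective space *)

Section Points.
Variable F : finFieldType.
Local Notation point := (proj_point F).
Implicit Types (P Q : point) (v w : 'rV[F]_4).

Definition rep P : 'rV[F]_4 := nz_row (val P).

Lemma rank_point P : \rank (val P) = 1%N.
Proof. by have /andP[_ /eqP] := valP P. Qed.

Lemma rep_neq0 P : rep P != 0.
Proof. by rewrite nz_row_eq0 -mxrank_eq0 rank_point. Qed.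

Lemma eqmx_rep P : (val P :=: rep P)%MS.
Proof.
apply/eqmx_sym/eqmxP; rewrite -(geq_leqif (mxrank_leqif_eq (nz_row_sub _))).
by rewrite rank_point lt0n mxrank_eq0 rep_neq0.
Qed.

Lemma in_linear_set (U : 'M[F]_4) P : (P \in linear_set U) = (rep P <= U)%MS.
Proof. by rewrite inE eqmx_rep. Qed.

Lemma rep_inj P Q : (rep P <= rep Q)%MS -> P = Q.
Proof.
move=> PQ; apply/val_inj; have /andP[/eqP <- _] := valP P.
have /andP[/eqP <- _] := valP Q; apply/genmxP.
rewrite -(geq_leqif (mxrank_leqif_eq _)) ?rank_point //.
by rewrite !eqmx_rep.
Qed.

Lemma point_onto v : v != 0 -> {P : point | (val P :=: v)%MS}.
Proof.
move=> v0; have h : (<<(<<v>>%MS : 'M_4)>>%MS == <<v>>%MS) && (\rank <<v>> == 1%N).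
  by rewrite genmx_id eqxx mxrank_gen eqn_leq rank_leq_row lt0n mxrank_eq0.
by exists (exist _ (<<v>>%MS : 'M_4) h); exact: genmxE.
Qed.

(** The fibers of the map from non-zero vectors to points have [#|F| - 1]
    elements, which is 1 in the field with four elements: sums over the points
    can be computed on vectors, where coordinates are available. *)
Lemma sum_points (A : nmodType) (G : 'rV[F]_4 -> A) :
    (forall (a : F) v, a != 0 -> G (a *: v) = G v) ->
  \sum_(v | v != 0) G v = (\sum_P G (rep P)) *+ #|F|.-1.
Proof.
move=> Ginv; transitivity (\sum_(v | v != 0) \sum_(P : point | (v <= val P)%MS) G v).
  apply: eq_bigr => v v0; have [P Pv] := point_onto v0.
  rewrite (big_pred1 P) // => Q; apply/idP/eqP => [vQ | ->]; last by rewrite Pv.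
  by apply/esym/rep_inj; rewrite -eqmx_rep Pv -eqmx_rep.
rewrite (exchange_big_dep predT) //= -sumrMnl; apply: eq_bigr => P _.
transitivity (\sum_(v in rowg (val P) :\ 0) G (rep P)).
  apply: eq_big => [v | v /andP[v0]]; first by rewrite !inE.
  rewrite eqmx_rep => /sub_rVP[a va]; rewrite va Ginv //.
  by apply: contraNneq v0 => a0; rewrite va a0 scale0r.
rewrite sumr_const; congr (_ *+ _).
have := cardsD1 0 (rowg (val P)); rewrite card_rowg rank_point expn1.
by rewrite inE sub0mx add1n => ->.
Qed.

Lemma card_linear_set (U : 'M[F]_4) :
  (#|linear_set U| * #|F|.-1 = #|F| ^ \rank U - 1)%N.
Proof.
have := @sum_points nat (fun v => nat_of_bool (v <= U)%MS).
rewrite -card_rowg (cardsD1 0) inE sub0mx addKn => /(_ _)/esym-eqn.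
transitivity ((\sum_P ((rep P <= U)%MS : nat))%R *+ #|F|.-1)%R.
  rewrite -mulr_natr natn; congr (_ * _)%N; rewrite -sum1_card big_mkcond.
  by apply: eq_bigr => P _; rewrite in_linear_set; case: ifP.
rewrite eqn => [|a v a0]; last by rewrite (eqmx_scale _ a0).
rewrite -sum1_card big_mkcond [RHS]big_mkcond; apply: eq_bigr => v _.
by rewrite !inE; case: eqP; case: (v <= U)%MS.
Qed.

Definition zero_set m (C : 'M[F]_(m, 4)) : {set point} :=
  [set P | rep P *m C^T == 0].

Lemma zero_setE m (C : 'M[F]_(m, 4)) : zero_set C = linear_set (kermx C^T).
Proof. by apply/setP=> P; rewrite in_linear_set !inE; apply/eqP/sub_kermxP. Qed.

Lemma subspaces_zero_set m k (C : 'M[F]_(m, 4)) :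
  (m + k = 4)%N -> row_free C -> zero_set C \in subspaces F k.
Proof.
move=> mk /eqP rC; rewrite zero_setE; apply: imset_f.
by rewrite inE mxrank_ker mxrank_tr rC -mk addKn.
Qed.

Lemma subspacesP m k S : (m + k = 4)%N -> S \in subspaces F k ->
  exists2 C : 'M[F]_(m, 4), row_free C & S = zero_set C.
Proof.
move=> mk /imsetP[U]; rewrite inE => /eqP rU ->.
have rC : \rank (cokermx U)^T = m by rewrite mxrank_tr mxrank_coker rU -mk addnK.
case: m / rC mk => mk.
exists (row_base (cokermx U)^T); first exact: row_base_free.
apply/setP=> P; rewrite in_linear_set submxE inE.
rewrite -trmx_eq0 -[in RHS]trmx_eq0 (trmx_mul (rep P)) (trmx_mul _ (row_base _)^T).
by rewrite trmxK -!submx0 (eqmxMr _ (eq_row_base _)).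
Qed.

End Points.

(** * Reduced monomials *)

(** The exponent at most 3 of the same power function, by [x ^ 4 = x]. *)
Definition reduce_exponent (m : nat) : nat :=
  if m is m'.+1 then (m' %% 3).+1 else 0.

(** The reduced exponents of the product of the monomials [x_i x_j ^ 2], for the
    pairs [(i, j)] listed in [p].  Indices and exponents are plain numbers so
    that the distinct monomials can be counted by computation. *)
Definition pair_exponents (p : seq (nat * nat)) : seq nat :=
  [seq reduce_exponent (foldr (fun ij x => (m == ij.1) + 2 * (m == ij.2) + x)%N 0%N p)
     | m <- iota 0 4].

Definition index_pairs : seq (nat * nat) :=
  [seq (i, j) | i <- iota 0 4, j <- iota 0 4].

Fixpoint pair_lists (c : nat) : seq (seq (nat * nat)) :=
  if c is c'.+1 then [seq ij :: p | ij <- index_pairs, p <- pair_lists c']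
  else [:: [::]].

Definition norm_exponents (c : nat) : seq (seq nat) :=
  undup [seq pair_exponents p | p <- pair_lists c].

(** Reduced exponents, of degree divisible by 3 so that the monomial is a
    function on the points, and not all zero so that it vanishes at 0. *)
Definition proper_exponents (e : seq nat) : bool :=
  [&& size e == 4%N, all (fun m => m <= 3)%N e, (3 %| sumn e)%N & (0 < sumn e)%N].

Lemma size_norm_exponents1 : size (norm_exponents 1) = 16%N.
Proof. by vm_compute. Qed.

Lemma size_norm_exponents2 : size (norm_exponents 2) = 60%N.
Proof. by vm_compute. Qed.

Lemma proper_norm_exponents1 : all proper_exponents (norm_exponents 1).
Proof. by vm_compute. Qed.

Lemma proper_norm_exponents2 : all proper_exponents (norm_exponents 2).
Proof. by vm_compute. Qed.

Lemma pair_exponents_inj :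
  {in index_pairs &, injective (fun ij => pair_exponents [:: ij])}.
Proof.
have /allrelP H : allrel (fun x y => (pair_exponents [:: x] == pair_exponents [:: y])
    ==> (x == y)) index_pairs index_pairs by vm_compute.
by move=> x y xin yin /eqP e; apply/eqP; move: (H x y xin yin); rewrite e.
Qed.

Lemma pair_lists_bound c p : p \in pair_lists c ->
  size p = c /\ {subset p <= index_pairs}.
Proof.
elim: c p => [|c IHc] p; first by rewrite inE => /eqP ->.
case/allpairsP=> -[ij p'] /= [ij_in /IHc[<- sub] ->]; split=> // x.
by rewrite inE => /predU1P[->|/sub].
Qed.

Lemma index_pairsP i j : ((i, j) \in index_pairs) = (i < 4)%N && (j < 4)%N.
Proof.
rewrite /index_pairs; apply/allpairsP/andP => [[[a b] [ai bj [-> ->]]]|[i4 j4]].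
  by move: ai bj; rewrite !mem_iota.
by exists (i, j); rewrite !mem_iota.
Qed.

Section Functions.
Variables (F : finFieldType) (hF : #|F| = 4%N).
Local Notation point := (proj_point F).
Local Notation vec := 'rV[F]_4.
Implicit Types (P Q : point) (v w s t : vec).

Lemma expf_reduce (a : F) m : a ^+ m = a ^+ reduce_exponent m.
Proof.
case: m => [|m] //=; elim/ltn_ind: m => m IHm.
have [m3|m3] := ltnP m 3; first by rewrite modn_small.
rewrite (expf_sub3 hF) // (_ : (m.+1 - 3 = (m - 3).+1)%N); last by lia.
rewrite IHm; last by lia.
by rewrite -(modnDr (m - 3)) subnK.
Qed.

Definition monomial (e : seq nat) v : F :=
  \prod_(m < 4) v 0 m ^+ nth 0%N e m.

Definition dual_multimonomial (e : seq nat) v : F :=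
  \prod_(m < 4) dual_monomial (nth 0%N e m) (v 0 m).

(** By the product structure, [F ^ 4] inherits the dual bases of [F]. *)
Lemma dual_multimonomialP e e' : proper_exponents e -> proper_exponents e' ->
  \sum_v dual_multimonomial e v * monomial e' v = (e == e')%:R.
Proof.
case/and4P=> /eqP se /(all_nthP 0%N) be _ _ /and4P[/eqP se' /(all_nthP 0%N) be' _ _].
rewrite (reindex (fun f : {ffun 'I_4 -> F} => \row_m f m)); last first.
  exists (fun v : vec => [ffun m => v 0 m]) => [f _|v _].
    by apply/ffunP=> m; rewrite ffunE mxE.
  by apply/rowP=> m; rewrite mxE ffunE.
transitivity (\prod_(m < 4) (nth 0%N e m == nth 0%N e' m)%:R : F).
  transitivity (\sum_(f : {ffun 'I_4 -> F}) \prod_(m < 4)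
      (dual_monomial (nth 0%N e m) (f m) * f m ^+ nth 0%N e' m)).
    apply: eq_bigr => f _; rewrite -big_split; apply: eq_bigr => m _ /=.
    by rewrite mxE.
  rewrite -(bigA_distr_bigA (fun (m : 'I_4) (a : F) =>
    dual_monomial (nth 0%N e m) a * a ^+ nth 0%N e' m)).
  by apply: eq_bigr => m _; rewrite (dual_monomialP hF) ?be ?be' ?se ?se'.
case: eqP => [->|ne]; first by apply: big1 => m _; rewrite eqxx.
have [/forallP h|] := boolP [forall m : 'I_4, nth 0%N e m == nth 0%N e' m].
  case: ne; apply: (@eq_from_nth _ 0%N) => [|m]; first by rewrite se se'.
  by rewrite se => m4; apply/eqP; exact: (h (Ordinal m4)).
rewrite negb_forall => /existsP[m /negPf hm].
by rewrite (bigD1 m) //= hm mul0r.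
Qed.

Lemma monomialZ e (a : F) v : proper_exponents e -> a != 0 ->
  monomial e (a *: v) = monomial e v.
Proof.
case/and4P=> /eqP se _ d3 _ a0; rewrite /monomial.
under eq_bigr do rewrite mxE exprMn.
rewrite big_split /= -[RHS]mul1r; congr (_ * _).
rewrite -(big_mkord xpredT (fun m => a ^+ nth 0%N e m)) -se.
rewrite -(big_nth 0%N xpredT (fun m => a ^+ m)).
rewrite -[LHS](_ : a ^+ sumn e = _).
  by case/dvdnP: d3 => k ->; rewrite mulnC exprM (expf3 hF) a0 expr1n.
by elim: (e) => [|x e' IHe]; rewrite ?big_nil // big_cons -IHe exprD.
Qed.

Lemma monomial0 e : proper_exponents e -> monomial e 0 = 0.
Proof.
case/and4P=> /eqP se _ _; rewrite /monomial => e0; apply/eqP/prodf_eq0.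
have /hasP[x xe x0] : has (fun m => 0 < m)%N e.
  by elim: (e) e0 => //= -[|x] e' IHe //=; rewrite add0n.
move: (xe); rewrite -index_mem se => xi; exists (Ordinal xi) => //=.
by rewrite mxE nth_index // expf_eq0 x0 eqxx.
Qed.

Local Notation n := #|{: point}|.

Definition pfun (g : point -> F) : 'rV[F]_n := \row_j g (enum_val j).
Definition ev (g : vec -> F) : 'rV[F]_n := pfun (fun P => g (rep P)).

Lemma pfunD g h : pfun (fun P => g P + h P) = pfun g + pfun h.
Proof. by apply/rowP=> j; rewrite !mxE. Qed.

Lemma pfunB g h : pfun (fun P => g P - h P) = pfun g - pfun h.
Proof. by apply/rowP=> j; rewrite !mxE. Qed.

Lemma pfun_sum I (r : seq I) (p : pred I) (g : I -> point -> F) :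
  pfun (fun P => \sum_(i <- r | p i) g i P) = \sum_(i <- r | p i) pfun (g i).
Proof.
by apply/rowP=> j; rewrite !mxE summxE; apply: eq_bigr => i _; rewrite mxE.
Qed.

Lemma eq_pfun g h : g =1 h -> pfun g = pfun h.
Proof. by move=> gh; apply/rowP=> j; rewrite !mxE gh. Qed.

Definition monomial_mx (X : seq (seq nat)) : 'M[F]_(size X, n) :=
  \matrix_(i < size X) ev (monomial (nth [::] X i)).

(** A combination that vanishes at all points vanishes at all vectors, by
    homogeneity and at 0 because no exponent is zero; its coefficients are then
    recovered by the dual basis. *)
Lemma monomial_mx_free X :
  uniq X -> all proper_exponents X -> row_free (monomial_mx X).
Proof.
move=> uX /(all_nthP [::]) pX; apply: inj_row_free => c cX0.
pose g v := \sum_i c 0 i * monomial (nth [::] X i) v.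
have g0 v : g v = 0.
  have [->|v0] := eqVneq v 0.
    by apply: big1 => i _; rewrite monomial0 ?mulr0 ?pX.
  have [P /eqmxP/andP[_]] := point_onto v0.
  rewrite eqmx_rep => /sub_rVP[a va].
  have a0 : a != 0 by apply: contraNneq v0 => a0; rewrite va a0 scale0r.
  have /rowP/(_ (enum_rank P)) := cX0; rewrite !mxE => <-.
  apply: eq_bigr => i _; rewrite !mxE enum_rankK va monomialZ //.
  exact: pX.
apply/rowP=> i; rewrite mxE.
transitivity (\sum_v dual_multimonomial (nth [::] X i) v * g v); last first.
  by apply: big1 => v _; rewrite g0 mulr0.
under eq_bigr do rewrite mulr_sumr.
rewrite exchange_big (bigD1 i) //= [X in _ + X]big1 => [|j ji].
  under eq_bigr do rewrite mulrCA.
  by rewrite -mulr_sumr dual_multimonomialP ?pX // eqxx mulr1 addr0.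
under eq_bigr do rewrite mulrCA.
rewrite -mulr_sumr dual_multimonomialP ?pX // nth_uniq //.
by rewrite eq_sym (negPf (_ : j != i :> nat)) ?mulr0.
Qed.

End Functions.

(** * Products of norm forms *)

Section Norms.
Variables (F : finFieldType) (hF : #|F| = 4%N).
Local Notation point := (proj_point F).
Local Notation vec := 'rV[F]_4.
Local Notation n := #|{: point}|.
Implicit Types (P Q : point) (v w s t : vec).

Definition dot v s : F := \sum_(i < 4) v 0 i * s 0 i.

Lemma dotC v s : dot v s = dot s v.
Proof. by apply: eq_bigr => i _; rewrite mulrC. Qed.

Lemma dotDl v w s : dot (v + w) s = dot v s + dot w s.
Proof. by rewrite -big_split; apply: eq_bigr => i _; rewrite mxE mulrDl. Qed.

Lemma dotZl a v s : dot (a *: v) s = a * dot v s.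
Proof. by rewrite mulr_sumr; apply: eq_bigr => i _; rewrite mxE mulrA. Qed.

Lemma dotDr v s t : dot v (s + t) = dot v s + dot v t.
Proof. by rewrite dotC dotDl !(dotC v). Qed.

Lemma dotZr a v s : dot v (a *: s) = a * dot v s.
Proof. by rewrite dotC dotZl dotC. Qed.

Lemma dot0r v : dot v 0 = 0.
Proof. by rewrite -(scale0r 0) dotZr mul0r. Qed.

(** The cube is the norm of [F] over its prime field; it is 1 at the non-zero
    elements. *)
Definition norm_form s v : F := dot v s ^+ 3.

Definition norm_prod (ss : seq vec) v : F := \prod_(s <- ss) norm_form s v.

Definition pair_monomial (ij : nat * nat) v : F :=
  v 0 (inord ij.1) * v 0 (inord ij.2) ^+ 2.

Definition pair_product (p : seq (nat * nat)) v : F :=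
  \prod_(ij <- p) pair_monomial ij v.

Lemma sumf_sqr I (r : seq I) (f : I -> F) :
  (\sum_(i <- r) f i) ^+ 2 = \sum_(i <- r) f i ^+ 2.
Proof.
apply: (big_morph (fun x => x ^+ 2)) => [x y|]; last by rewrite expr0n.
by rewrite sqrrD mulr2n addf_self // addr0.
Qed.

Lemma big_index_pairs (G : nat * nat -> F) :
  \sum_(ij <- index_pairs) G ij = \sum_(i < 4) \sum_(j < 4) G (val i, val j).
Proof.
rewrite /index_pairs big_allpairs_dep; symmetry.
rewrite -(big_mkord xpredT (fun i => \sum_(j < 4) G (i, val j))) /index_iota.
by apply: eq_bigr => i _; rewrite -(big_mkord xpredT (fun j => G (i, j))).
Qed.

(** The bihomogeneous expansion that makes Hermitian monomials appear: cubing
    is [z * z ^ 2], and squaring is additive. *)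
Lemma norm_form_expand s v : norm_form s v =
  \sum_(ij <- index_pairs) pair_monomial ij s * pair_monomial ij v.
Proof.
rewrite /norm_form exprS sumf_sqr big_distrlr /= big_index_pairs.
apply: eq_bigr => i _; apply: eq_bigr => j _.
by rewrite /pair_monomial /= !inord_val; ring.
Qed.

Lemma pair_productE p v : {subset p <= index_pairs} ->
  pair_product p v = monomial (pair_exponents p) v.
Proof.
move=> sub; rewrite /monomial.
under eq_bigr => m _ do rewrite (nth_map 0%N) ?size_iota // nth_iota // -expf_reduce //.
elim: p sub => [_|[i j] p IHp sub]; first by rewrite /pair_product big_nil big1.
have /andP[i4 j4] : (i < 4)%N && (j < 4)%N.
  by rewrite -index_pairsP sub // mem_head.
rewrite /pair_product big_cons -/(pair_product p v) IHp; last first.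
  by move=> x xp; rewrite sub // inE xp orbT.
under [RHS]eq_bigr do rewrite /= exprD exprD exprM.
rewrite !big_split /= /pair_monomial /=; congr (_ * _ * _).
  rewrite (bigD1 (inord i)) //= inordK // eqxx big1 ?mulr1 ?expr1 // => m.
  by rewrite -(inj_eq val_inj) /= inordK // => /negPf ->.
rewrite (bigD1 (inord j)) //= inordK // eqxx big1 ?mulr1 ?expr1 // => m.
by rewrite -(inj_eq val_inj) /= inordK // => /negPf ->; rewrite expr0.
Qed.

Lemma proper_pair ij : ij \in index_pairs -> proper_exponents (pair_exponents [:: ij]).
Proof. by move: ij; apply/allP; vm_compute. Qed.

Lemma dual_pair_monomial ij ij' : ij \in index_pairs -> ij' \in index_pairs ->
  \sum_s dual_multimonomial (pair_exponents [:: ij]) s * pair_monomial ij' s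
    = (ij == ij')%:R :> F.
Proof.
move=> ijP ijP'; transitivity (\sum_s dual_multimonomial (pair_exponents [:: ij]) s
    * monomial (pair_exponents [:: ij']) s : F).
  apply: eq_bigr => s _; congr (_ * _); rewrite -pair_productE.
    by rewrite /pair_product big_seq1.
  by move=> x; rewrite inE => /eqP->.
rewrite dual_multimonomialP ?proper_pair //; congr (nat_of_bool _)%:R.
by apply/eqP/eqP => [/pair_exponents_inj -> | ->].
Qed.

(** The coefficients in [s] of the expansion [norm_form_expand], extracted by
    the dual basis. *)
Lemma pair_monomial_extract ij v : ij \in index_pairs ->
  pair_monomial ij v =
  \sum_s dual_multimonomial (pair_exponents [:: ij]) s * norm_form s v.
Proof.
move=> ijP; under eq_bigr do rewrite norm_form_expand mulr_sumr.
rewrite exchange_big /= (bigD1_seq ij) //=.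
under eq_bigr do rewrite mulrA.
rewrite -mulr_suml dual_pair_monomial // eqxx mul1r big1_seq ?addr0 // => ij'.
case/andP=> ne ijP'; under eq_bigr do rewrite mulrA.
by rewrite -mulr_suml dual_pair_monomial // eq_sym (negPf ne) mul0r.
Qed.

Lemma norm_prod_sub ss :
  (ev (norm_prod ss) <= monomial_mx F (norm_exponents (size ss)))%MS.
Proof.
(* Norm forms are expanded one at a time; p lists the monomials obtained. *)
suff H p : {subset p <= index_pairs} ->
    (ev (fun v => (norm_prod ss v * pair_product p v)%R)
      <= monomial_mx F (norm_exponents (size ss + size p)))%MS.
  rewrite (_ : ev _ = ev (fun v => norm_prod ss v * pair_product [::] v)).
    by have := H [::]; rewrite addn0; apply.
  by apply: eq_pfun => P; rewrite /pair_product big_nil mulr1.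
elim: ss p => [|s ss IHss] p sub.
  set e := pair_exponents p.
  have e_in : e \in norm_exponents (size p).
    rewrite mem_undup map_f //.
    elim: p sub {e} => [|ij p IHp] sub //.
    apply/allpairs_f; first exact/sub/mem_head.
    by apply: IHp => x xp; rewrite sub // inE xp orbT.
  set X := norm_exponents (size p) in e_in *.
  have i_lt : (index e X < size X)%N by rewrite index_mem.
  rewrite (_ : ev _ = row (Ordinal i_lt) (monomial_mx F X)) ?row_sub //.
  apply/rowP=> j; rewrite !mxE /= nth_index // /norm_prod big_nil mul1r.
  exact: pair_productE.
rewrite (_ : ev _ = \sum_(ij <- index_pairs) pair_monomial ij s *:
    ev (fun v => norm_prod ss v * pair_product (ij :: p) v)); last first.
  apply/rowP=> j; rewrite !mxE summxE /norm_prod big_cons norm_form_expand.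
  rewrite !mulr_suml; apply: eq_bigr => ij _; rewrite !mxE.
  by rewrite /pair_product big_cons; ring.
rewrite big_seq; apply: summx_sub => ij ijP; apply: scalemx_sub.
rewrite addSnnS; apply: (IHss (ij :: p)) => x.
by rewrite inE => /predU1P[->|/sub].
Qed.

(** The products of [c] norm forms and the products of [c] monomials
    [x_i x_j ^ 2] span the same functions: one inclusion is expansion, the
    other is extraction of coefficients, one linear form at a time. *)
Lemma rank_norm_span c m (D : 'M[F]_(m, n)) :
    all proper_exponents (norm_exponents c) ->
    (forall ss, size ss = c -> (ev (norm_prod ss) <= D)%MS) ->
    (D <= monomial_mx F (norm_exponents c))%MS ->
  \rank D = size (norm_exponents c).
Proof.
move=> proper_c normD Dmon.
have H p ss : {subset p <= index_pairs} -> (size p + size ss = c)%N ->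
    (ev (fun v => (pair_product p v * norm_prod ss v)%R) <= D)%MS.
  elim: p ss => [|ij p IHp] ss sub sz.
    rewrite (_ : ev _ = ev (norm_prod ss)) ?normD //.
    by apply: eq_pfun => P; rewrite /pair_product big_nil mul1r.
  rewrite (_ : ev _ = \sum_s dual_multimonomial (pair_exponents [:: ij]) s *:
      ev (fun v => pair_product p v * norm_prod (s :: ss) v)).
    apply: summx_sub => s _; apply: scalemx_sub; apply: IHp => [x xp|].
      by rewrite sub // inE xp orbT.
    by rewrite /= addnS.
  apply/rowP=> j; rewrite !mxE summxE /pair_product big_cons.
  rewrite (pair_monomial_extract _ (sub _ (mem_head _ _))) !mulr_suml.
  by apply: eq_bigr => s _; rewrite !mxE /norm_prod big_cons; ring.
have Dfull : (monomial_mx F (norm_exponents c) <= D)%MS.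
  apply/row_subP=> i; rewrite rowK.
  have : nth [::] (norm_exponents c) i \in norm_exponents c by exact: mem_nth.
  rewrite mem_undup => /mapP[p p_in ->]; have [sz sub] := pair_lists_bound p_in.
  rewrite (_ : ev _ = ev (fun v => pair_product p v * norm_prod [::] v)).
    by apply: H; rewrite ?addn0.
  apply: eq_pfun => P; rewrite /norm_prod big_nil mulr1.
  exact/esym/pair_productE.
apply/eqP; rewrite eqn_leq (leq_trans (mxrankS Dmon) (rank_leq_row _)) /=.
have /eqP <- := monomial_mx_free hF (undup_uniq _) proper_c.
exact: mxrankS.
Qed.

End Norms.

(** * Codes of planes and of lines *)

Section Codes.
Variables (F : finFieldType) (hF : #|F| = 4%N).
Local Notation point := (proj_point F).
Local Notation vec := 'rV[F]_4.
Local Notation n := #|{: point}|.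
Implicit Types (P Q : point) (v w s t : vec) (S : {set point}).

Definition indicator S : 'rV[F]_n := pfun (fun P => (P \in S)%:R).

Definition code (k : nat) : 'M[F]_n :=
  (\sum_(S in subspaces F k) <<indicator S>>)%MS.

Definition diff_code (k : nat) : 'M[F]_n :=
  (\sum_(S in subspaces F k) \sum_(S' in subspaces F k)
     <<indicator S - indicator S'>>)%MS.

Lemma indicator_code k S : S \in subspaces F k -> (indicator S <= code k)%MS.
Proof. by move=> Sk; rewrite -(genmxE (indicator S)); exact: (sumsmx_sup S). Qed.

Lemma diff_codeP k S S' : S \in subspaces F k -> S' \in subspaces F k ->
  (indicator S - indicator S' <= diff_code k)%MS.
Proof.
move=> Sk Sk'; rewrite -(genmxE (_ - _)).
by apply: (sumsmx_sup S) => //; exact: (sumsmx_sup S').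
Qed.

Lemma diff_code_sub k m (A : 'M[F]_(m, n)) :
    (forall S S', S \in subspaces F k -> S' \in subspaces F k ->
       (indicator S - indicator S' <= A)%MS) ->
  (diff_code k <= A)%MS.
Proof.
by move=> H; apply/sumsmx_subP => S Sk; apply/sumsmx_subP => S' Sk'; rewrite genmxE H.
Qed.

(** The indicator of the common zeros of [s] and [t]: a line when they are
    independent, a plane when [t = 0], everything when both are 0. *)
Definition zero_form s t v : F := (1 + norm_form s v) * (1 + norm_form t v).

Lemma mulmx_dot v s : (v *m s^T) 0 0 = dot v s.
Proof. by rewrite mxE; apply: eq_bigr => i _; rewrite mxE. Qed.

Lemma norm_form_zero s v : 1 + norm_form s v = (dot v s == 0)%:R.
Proof.
rewrite /norm_form (expf3 hF); case: eqP => _ /=; first by rewrite addr0.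
by rewrite addf_self.
Qed.

Lemma zero_form_pair s t :
  indicator (zero_set (col_mx s t)) = ev (zero_form s t).
Proof.
apply: eq_pfun => P; rewrite inE /zero_form !norm_form_zero -natrM mulnb.
congr (nat_of_bool _)%:R; rewrite tr_col_mx mul_mx_row row_mx_eq0.
by rewrite -!mulmx_dot; congr (_ && _); apply/eqP/eqP => [->|h]; rewrite ?mxE //;
   apply/matrixP=> i j; rewrite !ord1 h mxE.
Qed.

Lemma zero_form_single s : indicator (zero_set s) = ev (zero_form s 0).
Proof.
apply: eq_pfun => P; rewrite inE /zero_form !norm_form_zero dot0r eqxx mulr1.
by congr (nat_of_bool _)%:R; rewrite -mulmx_dot; apply/eqP/eqP => [->|h];
  rewrite ?mxE //; apply/matrixP=> i j; rewrite !ord1 h mxE.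
Qed.

Lemma zero_formC s t v : zero_form s t v = zero_form t s v.
Proof. exact: mulrC. Qed.

(** The five lines of the plane [s] through one of its points cover it once
    away from that point and five times, hence once in [F], at the point.  The
    identity holds for all [s]; for [s = 0] it concerns the five planes through
    a line. *)
Lemma pencil s t1 t2 v :
  \sum_(a : F) zero_form s (t1 + a *: t2) v + zero_form s t2 v = zero_form s 0 v.
Proof.
rewrite /zero_form -mulr_sumr -mulrDr; congr (_ * _).
rewrite big_split /= sumr_const hF (natf_odd hF) /= add0r.
under eq_bigr do rewrite /norm_form dotDr dotZr.
rewrite (sumf_cube hF) addrC -addrA (addf_self hF) addr0.
by rewrite /norm_form dot0r expr0n addr0.
Qed.

(** As [5 = 1] in [F], congruence to [g] modulo [D] passes from the members of a
    pencil to their sum. *)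
Lemma pencil_sub m (D : 'M[F]_(m, n)) (g : 'rV[F]_n) s t1 t2 :
    (forall a : F, (ev (zero_form s (t1 + a *: t2)) - g <= D)%MS) ->
    (ev (zero_form s t2) - g <= D)%MS ->
  (ev (zero_form s 0) - g <= D)%MS.
Proof.
move=> H1 H2.
rewrite (_ : _ - g = \sum_(a : F) (ev (zero_form s (t1 + a *: t2)) - g)
    + (ev (zero_form s t2) - g)).
  by apply: addmx_sub => //; apply: summx_sub.
rewrite sumrB sumr_const hF addrACA -opprD; congr (_ - _).
  by rewrite -pfun_sum -pfunD; apply: eq_pfun => P; rewrite pencil.
by apply/rowP=> j; rewrite mxE mulmxnE -mulrSr -mulr_natr (natf_odd hF) mulr1.
Qed.

Lemma line_form s t : row_free (col_mx s t) ->
  exists2 S, S \in subspaces F 2 & indicator S = ev (zero_form s t).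
Proof.
move=> st; exists (zero_set (col_mx s t)); last exact: zero_form_pair.
exact: subspaces_zero_set.
Qed.

Lemma lineP S : S \in subspaces F 2 ->
  exists s t : vec, row_free (col_mx s t) /\ indicator S = ev (zero_form s t).
Proof.
move=> /(@subspacesP F 2 2 S erefl)[C fC ->].
exists (@usubmx F 1 1 4 C), (@dsubmx F 1 1 4 C).
by rewrite -zero_form_pair vsubmxK.
Qed.

Lemma plane_form s : s != 0 ->
  exists2 S, S \in subspaces F 3 & indicator S = ev (zero_form s 0).
Proof.
move=> s0; exists (zero_set s); last exact: zero_form_single.
by apply: subspaces_zero_set; rewrite // /row_free eqn_leq rank_leq_row lt0n mxrank_eq0.
Qed.

Lemma planeP S : S \in subspaces F 3 ->
  exists2 s : vec, s != 0 & S = zero_set s.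
Proof.
move=> /(@subspacesP F 1 3 S erefl)[s fs ->]; exists s => //.
by rewrite -mxrank_eq0 (eqP fs).
Qed.

Lemma not_full m (U : 'M[F]_(m, 4)) : (\rank U < 4)%N -> exists v, ~~ (v <= U)%MS.
Proof.
move=> rU; have : ~~ (1%:M <= U)%MS.
  by rewrite sub1mx /row_full neq_ltn rU.
by case/row_subPn=> i vi; exists (row i 1%:M).
Qed.

Lemma row_free_pair s t : s != 0 -> ~~ (t <= s)%MS -> row_free (col_mx s t).
Proof.
move=> s0 ts; rewrite /row_free eqn_leq rank_leq_row -addsmxE.
have rs : \rank s = 1%N by apply/eqP; rewrite eqn_leq rank_leq_row lt0n mxrank_eq0.
apply: leq_trans (rank_ltmx (_ : (s < s + t)%MS)); first by rewrite rs.
by rewrite /ltmx addsmxSl addsmx_sub submx_refl.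
Qed.

Lemma complete_pencil s : s != 0 -> exists t1 t2 : vec,
  row_free (col_mx s t2) /\ forall a : F, row_free (col_mx s (t1 + a *: t2)).
Proof.
move=> s0; have rs : (\rank s <= 1)%N := rank_leq_row _.
have [t2 t2s] := not_full (leq_ltn_trans rs (isT : 1 < 4)%N).
have [|t1 t1s] := @not_full _ (col_mx s t2).
  exact: leq_ltn_trans (rank_leq_row _) _.
exists t1, t2; split=> [|a]; apply: row_free_pair => //.
apply: contra t1s => h; rewrite -[t1](addrK (a *: t2)) -addsmxE.
by apply: addmx_sub_adds => //; rewrite eqmx_opp scalemx_sub.
Qed.

(** The whole space, the case [s = 0], is the sum of a pencil of planes. *)
Lemma norm_form_sub m (D : 'M[F]_(m, n)) (g : 'rV[F]_n) :
    (forall s, s != 0 -> (ev (zero_form s 0) - g <= D)%MS) ->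
  forall s, (ev (zero_form s 0) - g <= D)%MS.
Proof.
move=> H s; have [->|] := eqVneq s 0; last exact: H.
have [v v0] : exists v : vec, v != 0.
  have [|v] := @not_full _ (0 : vec); first by rewrite mxrank0.
  by move=> v0; exists v; apply: contra v0 => /eqP->; exact: sub0mx.
have [t1 [t2 [f2 f1]]] := complete_pencil v0.
have nz t : row_free (col_mx v t) -> t != 0.
  move=> /eqP; rewrite -addsmxE; apply: contra_eq_neq => ->.
  by rewrite addsmx0 neq_ltn ltnS rank_leq_row.
have sym t : ev (zero_form 0 t) = ev (zero_form t 0).
  by apply: eq_pfun => P; exact: zero_formC.
by apply: (pencil_sub (t1 := t1) (t2 := t2)) => [a|]; rewrite sym; apply/H/nz.
Qed.

Lemma subspaces_inh k : (k <= 4)%N -> exists S, S \in subspaces F k.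
Proof.
move=> k4; exists (linear_set (pid_mx k)); apply: imset_f.
by rewrite inE rank_pid_mx.
Qed.

Lemma submxB m1 m2 (A B : 'M[F]_(m1, n)) (C : 'M_(m2, n)) :
  (A <= C)%MS -> (B <= C)%MS -> (A - B <= C)%MS.
Proof. by move=> AC BC; rewrite addmx_sub // eqmx_opp. Qed.

(** The cube of a linear form is the difference between the whole space and a
    plane. *)
Lemma plane_code_norm s : (ev (norm_form s) <= diff_code 3)%MS.
Proof.
have [S0 S0P] := subspaces_inh (isT : 3 <= 4)%N.
have H t : (ev (zero_form t 0) - indicator S0 <= diff_code 3)%MS.
  move: t; apply: norm_form_sub => t t0.
  by have [S SP <-] := plane_form t0; exact: diff_codeP.
have := submxB (H s) (H 0); rewrite opprB addrA subrK -pfunB.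
congr (_ <= _)%MS; apply: eq_pfun => P.
by rewrite /zero_form /norm_form !dot0r !expr0n /=; ring.
Qed.

Lemma plane_sub_line_code s S : S \in subspaces F 2 ->
  (ev (zero_form s 0) - indicator S <= diff_code 2)%MS.
Proof.
move=> SP; move: s; apply: norm_form_sub => s s0.
have [t1 [t2 [f2 f1]]] := complete_pencil s0.
apply: (pencil_sub (t1 := t1) (t2 := t2)) => [a|].
  by have [S' SP' <-] := line_form (f1 a); exact: diff_codeP.
by have [S' SP' <-] := line_form f2; exact: diff_codeP.
Qed.

Lemma zero_form_line_code s t S : S \in subspaces F 2 ->
  (ev (zero_form s t) - indicator S <= diff_code 2)%MS.
Proof.
move=> SP; have H u := plane_sub_line_code u SP.
have [->|s0] := eqVneq s 0.
  by rewrite (_ : ev _ = ev (zero_form t 0)) //; apply: eq_pfun => P; exact: zero_formC.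
have [/sub_rVP[a ->]|ts] := boolP (t <= s)%MS; last first.
  by have [S' SP' <-] := line_form (row_free_pair s0 ts); exact: diff_codeP.
have [->|a0] := eqVneq a 0; first by rewrite scale0r.
rewrite (_ : ev _ = ev (zero_form s 0)) //; apply: eq_pfun => P.
rewrite /zero_form !norm_form_zero dotZr mulf_eq0 (negPf a0) dot0r eqxx mulr1.
by rewrite -natrM mulnb andbb.
Qed.

(** Inclusion and exclusion: the product of two cubes is an alternating sum of
    the indicators of a line, two planes and the space, with coefficients of
    sum 0. *)
Lemma line_code_norm s t :
  (ev (fun v => (norm_form s v * norm_form t v)%R) <= diff_code 2)%MS.
Proof.
have [S SP] := subspaces_inh (isT : 2 <= 4)%N.
have H u w := zero_form_line_code u w SP.
have := addmx_sub (submxB (H s t) (H s 0)) (submxB (H 0 0) (H 0 t)).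
rewrite !opprB !addrA !subrK -pfunB -pfunD -pfunB.
congr (_ <= _)%MS; apply: eq_pfun => P.
by rewrite /zero_form /norm_form !dot0r !expr0n /=; ring.
Qed.

Lemma rank_plane_diff_code : \rank (diff_code 3) = 16%N.
Proof.
rewrite -size_norm_exponents1; apply: (rank_norm_span hF proper_norm_exponents1).
  case=> [|s [|]] // _; rewrite (_ : ev _ = ev (norm_form s)) ?plane_code_norm //.
  by apply: eq_pfun => P; rewrite /norm_prod big_seq1.
apply: diff_code_sub => S S' /planeP[s _ ->] /planeP[t _ ->].
rewrite !zero_form_single -pfunB.
rewrite (_ : pfun _ = ev (norm_prod [:: s]) - ev (norm_prod [:: t])).
  apply: submxB; first exact: (norm_prod_sub hF [:: s]).
  exact: (norm_prod_sub hF [:: t]).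
rewrite -pfunB; apply: eq_pfun => P; rewrite /norm_prod !big_seq1.
by rewrite /zero_form /norm_form !dot0r !expr0n /=; ring.
Qed.

Lemma rank_line_diff_code : \rank (diff_code 2) = 60%N.
Proof.
rewrite -size_norm_exponents2; apply: (rank_norm_span hF proper_norm_exponents2).
  case=> [|s [|t [|]]] // _.
  rewrite (_ : ev _ = ev (fun v => norm_form s v * norm_form t v)) ?line_code_norm //.
  by apply: eq_pfun => P; rewrite /norm_prod big_cons big_seq1.
pose A := monomial_mx F (norm_exponents 2).
have H s t : (ev (zero_form s t) - ev (fun=> 1%R) <= A)%MS.
  (* A single cube is its own square, hence also a product of two cubes. *)
  rewrite (_ : _ - _ = ev (norm_prod [:: s; s]) + ev (norm_prod [:: t; t])
     + ev (norm_prod [:: s; t])).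
    by rewrite !addmx_sub ?(norm_prod_sub hF [:: _; _]).
  rewrite -!pfunD -pfunB; apply: eq_pfun => P.
  have sqr u : norm_form u (rep P) * norm_form u (rep P) = norm_form u (rep P).
    by rewrite /norm_form !(expf3 hF) -natrM mulnb andbb.
  by rewrite /norm_prod !big_cons !big_nil !mulr1 !sqr /zero_form; ring.
apply: diff_code_sub => S S' /lineP[s [t [_ ->]]] /lineP[s' [t' [_ ->]]].
by have := submxB (H s t) (H s' t'); rewrite opprB addrA subrK.
Qed.

End Codes.

(** * Sums of coordinates, and sums of cubic forms on lines *)

Section CodeSums.
Variables (F : finFieldType) (hF : #|F| = 4%N).
Local Notation point := (proj_point F).
Local Notation vec := 'rV[F]_4.
Local Notation n := #|{: point}|.
Implicit Types (P Q : point) (v w s t : vec) (S : {set point}).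

Lemma card_points : n = 85%N.
Proof.
have := card_linear_set (1%:M : 'M[F]_4).
rewrite mxrank1 hF (_ : linear_set _ = setT) ?cardsT; last first.
  by apply/setP=> P; rewrite in_linear_set submx1 inE.
by move=> /(congr1 (fun m => m %/ 3)%N); rewrite mulnK.
Qed.

Lemma card_subspace k S : S \in subspaces F k -> (3 * #|S| = 4 ^ k - 1)%N.
Proof.
case/imsetP=> U; rewrite inE => /eqP rU ->.
by have := card_linear_set U; rewrite hF rU mulnC.
Qed.

Lemma card_eq_subspaces k S S' :
  S \in subspaces F k -> S' \in subspaces F k -> #|S| = #|S'|.
Proof.
move=> /card_subspace Sk /card_subspace Sk'; apply/eqP.
by rewrite -(eqn_pmul2l (isT : 0 < 3)%N) Sk Sk'.
Qed.

Definition coord_sum (w : 'rV[F]_n) : F := (w *m const_mx 1 : 'M_1) 0 0.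

Lemma coord_sumE (w : 'rV[F]_n) : coord_sum w = \sum_j w 0 j.
Proof. by rewrite /coord_sum mxE; apply: eq_bigr => j _; rewrite mxE mulr1. Qed.

Lemma coord_sumB (u w : 'rV[F]_n) : coord_sum (u - w) = coord_sum u - coord_sum w.
Proof. by rewrite /coord_sum mulmxBl !mxE. Qed.

Lemma coord_sumZ a (w : 'rV[F]_n) : coord_sum (a *: w) = a * coord_sum w.
Proof. by rewrite /coord_sum -scalemxAl mxE. Qed.

Lemma sum_enum_val (A : nmodType) (g : point -> A) :
  \sum_(j < n) g (enum_val j) = \sum_P g P.
Proof. by rewrite [RHS](reindex _ (onW_bij _ (enum_val_bij _))). Qed.

Lemma coord_sum_indicator S : coord_sum (indicator S) = (odd #|S|)%:R.
Proof.
rewrite coord_sumE; under eq_bigr do rewrite mxE.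
rewrite (sum_enum_val (fun P => (P \in S)%:R)) -(natf_odd hF) -sum1_card natr_sum.
by rewrite [RHS]big_mkcond; apply: eq_bigr => P _; case: (P \in S).
Qed.

Lemma coord_sum_subspace k S : (0 < k)%N -> S \in subspaces F k ->
  coord_sum (indicator S) = 1.
Proof.
move=> k0 Sk; rewrite coord_sum_indicator (_ : odd _) //.
have := congr1 odd (card_subspace Sk).
by rewrite oddM oddB ?expn_gt0 //= oddX; case: k k0 {Sk} => // k _ ->.
Qed.

Lemma diff_code_code k : (diff_code F k <= code F k)%MS.
Proof.
by apply: diff_code_sub => S S' Sk Sk'; apply: submxB; exact: indicator_code.
Qed.

Lemma coord_sum_diff_code k : (0 < k)%N -> diff_code F k *m (const_mx 1 : 'cV_n) = 0.
Proof.
move=> k0; apply/sub_kermxP/diff_code_sub => S S' Sk Sk'; apply/sub_kermxP.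
have := coord_sumB (indicator S) (indicator S').
rewrite !(coord_sum_subspace k0) // subrr /coord_sum => E.
by apply/matrixP=> i j; rewrite !ord1 E mxE.
Qed.

(** Subspaces have an odd number of points, so the linear map that subtracts
    from [w] the multiple of a fixed subspace with the same sum of coordinates
    sends every subspace to a difference of two. *)
Lemma code_coord_sum0 k (w : 'rV[F]_n) :
    (0 < k <= 4)%N -> (w <= code F k)%MS -> coord_sum w = 0 ->
  (w <= diff_code F k)%MS.
Proof.
case/andP=> k0 k4; have [S0 S0k] := subspaces_inh F k4.
pose M : 'M[F]_n := 1%:M - const_mx 1 *m indicator S0.
have ME (u : 'rV_n) : u *m M = u - coord_sum u *: indicator S0.
  rewrite mulmxBr mulmx1 mulmxA; congr (_ - _).
  rewrite -mul_scalar_mx; congr (_ *m _).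
  by apply/matrixP=> i j; rewrite !ord1 [RHS]mxE eqxx.
move=> wk w0; have wM : w = w *m M by rewrite ME w0 scale0r subr0.
rewrite wM.
apply: submx_trans (submxMr M wk) _; rewrite sumsmxMr; apply/sumsmx_subP=> S Sk.
rewrite (eqmxMr _ (genmxE _)) ME (coord_sum_subspace k0 Sk) scale1r.
exact: diff_codeP.
Qed.

Lemma point_subspace P : [set P] \in subspaces F 1.
Proof.
apply/imsetP; exists (val P); first by rewrite inE rank_point.
apply/setP=> Q; rewrite inE in_linear_set; apply/eqP/idP => [->|QP].
  by rewrite eqmx_rep.
by apply: rep_inj; rewrite -(eqmx_rep P).
Qed.

Lemma point_code_full (w : 'rV[F]_n) : (w <= code F 1)%MS.
Proof.
rewrite (_ : w = \sum_j w 0 j *: indicator [set enum_val j]).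
  by apply: summx_sub => j _; apply/scalemx_sub/indicator_code/point_subspace.
apply/rowP=> j; rewrite summxE (bigD1 j) //= !mxE inE eqxx mulr1.
rewrite big1 ?addr0 // => i ij.
by rewrite !mxE inE (inj_eq enum_val_inj) eq_sym (negPf ij) mulr0.
Qed.

(** Differences of points form the hyperplane of sum 0. *)
Lemma rank_point_diff_code : \rank (diff_code F 1) = 84%N.
Proof.
have [S0 S01] := subspaces_inh F (isT : 1 <= 4)%N.
apply/eqP; rewrite eqn_leq; apply/andP; split.
  rewrite -ltnS -[85%N]card_points ltn_neqAle rank_leq_row andbT.
  apply/negP=> full.
  have /submxP[D ind] : (indicator S0 <= diff_code F 1)%MS by apply: submx_full.
  have := coord_sum_subspace (isT : 0 < 1)%N S01; rewrite /coord_sum ind -mulmxA.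
  by rewrite coord_sum_diff_code // mulmx0 mxE => /esym/eqP; rewrite oner_eq0.
rewrite -ltnS; apply: leq_trans (eq_leq (esym card_points)) _.
apply: leq_trans (eq_leq (esym (mxrank1 F n))) _.
apply: leq_trans (_ : \rank (diff_code F 1 + indicator S0)%MS <= _)%N.
  apply/mxrankS/row_subP=> i; set w := row i _.
  rewrite -[w](subrK (coord_sum w *: indicator S0)) addmx_sub_adds ?scalemx_sub //.
  apply: code_coord_sum0 => //; first exact: point_code_full.
  by rewrite coord_sumB coord_sumZ (coord_sum_subspace (isT : 0 < 1)%N S01) mulr1 subrr.
apply: leq_trans (mxrank_adds_leqif _ _) _.
by rewrite -[X in (_ <= X)%N]addn1 leq_add2l rank_leq_row.
Qed.

Lemma zero_form_code s t : (ev (zero_form s t) <= code F 2)%MS.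
Proof.
have [S S2] := subspaces_inh F (isT : 2 <= 4)%N.
rewrite -[ev _](subrK (indicator S)) addmx_sub ?indicator_code //.
exact: submx_trans (zero_form_line_code hF s t S2) (diff_code_code 2).
Qed.

Definition cubic (a b c : vec) v : F := dot v a * dot v b * dot v c.

(** With coordinates [(x, y)] on [U], the sum over [x] picks the coefficient of
    [x ^ 3], which no longer involves the four values of [y]. *)
Lemma sum_rank2 (U : 'M[F]_4) a b c : \rank U = 2%N ->
  \sum_(v in rowg U) cubic a b c v = 0.
Proof.
move=> rU; have e : \rank U = (1 + 1)%N by [].
pose B := castmx (e, erefl 4%N) (row_base U).
have BU : (B :=: U)%MS by apply: eqmx_trans (eqmx_cast _ _) (eq_row_base U).
pose u := usubmx B; pose w := dsubmx B.
pose h (xy : F * F) := xy.1 *: u + xy.2 *: w.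
have hU : rowg U = h @: [set: F * F].
  apply/setP=> v; rewrite inE -BU; apply/idP/imsetP => [/submxP[D ->]|[[x y] _ ->]].
    exists (lsubmx D 0 0, rsubmx D 0 0); first by rewrite inE.
    rewrite /h /= -!mul_scalar_mx -!mx11_scalar -mul_row_col.
    by rewrite hsubmxK vsubmxK.
  have [uB wB] : (u <= B)%MS /\ (w <= B)%MS.
    by apply/andP; rewrite -col_mx_sub vsubmxK.
  by rewrite addmx_sub ?scalemx_sub.
have h_inj : {in [set: F * F] &, injective h}.
  apply/imset_injP; rewrite -hU card_rowg rU hF cardsT.
  by rewrite card_prod hF.
rewrite hU big_imset //=; under eq_bigl do rewrite inE.
rewrite -(pair_bigA _ (fun x y => cubic a b c (h (x, y)))) exchange_big /=.
rewrite (eq_bigr (fun=> cubic a b c u)) => [|y _]; last first.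
  rewrite /cubic /h /= -(sumf_cubic hF (y * dot w a) _ (y * dot w b) _ (y * dot w c)).
  by apply: eq_bigr => x _; rewrite !dotDl !dotZl; ring.
by rewrite sumr_const hF -mulr_natr (natf_odd hF) mulr0.
Qed.

Lemma sum_line_cubic a b c S : S \in subspaces F 2 ->
  \sum_(P in S) cubic a b c (rep P) = 0.
Proof.
case/imsetP=> U; rewrite inE => /eqP rU ->.
have := @sum_points F F (fun v => (v <= U)%MS%:R * cubic a b c v).
rewrite hF -[X in _ = X]mulr_natr (natf_odd hF) mulr1 => E.
transitivity (\sum_P (rep P <= U)%MS%:R * cubic a b c (rep P)).
  by rewrite big_mkcond; apply: eq_bigr => P _; rewrite in_linear_set; case: ifP;
     rewrite ?mul1r ?mul0r.
rewrite -E => [|x v x0]; last first.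
  rewrite (eqmx_scale _ x0) /cubic !dotZl.
  transitivity ((v <= U)%MS%:R * (x ^+ 3 * cubic a b c v)); first by rewrite /cubic; ring.
  by rewrite (expf3 hF) x0 mul1r.
rewrite -[RHS](sum_rank2 a b c rU) [RHS]big_mkcond [LHS]big_mkcond /=.
apply: eq_bigr => v _; rewrite inE; case: eqP => [->|_] /=.
  by rewrite /cubic /dot big1 ?mul0r ?if_same // => i _; rewrite mxE mul0r.
by case: ifP; rewrite ?mul1r ?mul0r.
Qed.

Lemma code_cubic a b c (w : 'rV[F]_n) : (w <= code F 2)%MS ->
  \sum_j w 0 j * cubic a b c (rep (enum_val j)) = 0.
Proof.
pose C : 'cV[F]_n := \col_j cubic a b c (rep (enum_val j)).
move=> w2; suff: (w <= kermx C)%MS.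
  move/sub_kermxP/matrixP/(_ 0 0); rewrite !mxE => E; rewrite -[RHS]E.
  by apply: eq_bigr => j _; rewrite mxE.
apply: submx_trans w2 _; apply/sumsmx_subP=> S S2; rewrite genmxE.
apply/sub_kermxP/matrixP=> i j; rewrite !ord1 !mxE -[RHS](sum_line_cubic a b c S2).
rewrite [RHS]big_mkcond -[RHS]sum_enum_val; apply: eq_bigr => k _; rewrite !mxE.
by case: ifP; rewrite ?mul1r ?mul0r.
Qed.

End CodeSums.

(** * Submodules generated by a set *)

Section Submodules.
Variable V : zmodType.
Implicit Types (K : V -> Prop) (x y : V).

Lemma submoduleN K x : int_submodule K -> K x -> K (- x).
Proof. by case=> K0 KB Kx; rewrite -sub0r; exact: KB. Qed.

Lemma submoduleD K x y : int_submodule K -> K x -> K y -> K (x + y).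
Proof.
by move=> HK Kx Ky; rewrite -[y]opprK; apply: (HK.2) => //; exact: submoduleN.
Qed.

Lemma submodule_sum K I (r : seq I) (f : I -> V) :
  int_submodule K -> (forall i, K (f i)) -> K (\sum_(i <- r) f i).
Proof.
move=> HK Kf; elim: r => [|i r IHr]; first by rewrite big_nil; case: HK.
by rewrite big_cons; exact: submoduleD.
Qed.

Lemma submodule_mulrz K x (z : int) : int_submodule K -> K x -> K (x *~ z).
Proof.
move=> HK Kx; have Kn m : K (x *+ m).
  by elim: m => [|m IHm]; [case: HK | rewrite mulrSr; exact: submoduleD].
case: z => m; first exact: Kn.
by rewrite NegzE mulrNz; exact: submoduleN (Kn _).
Qed.

Lemma inIntSpan_submodule K m (s : m.-tuple V) x : int_submodule K ->
  (forall i, K (tnth s i)) -> inIntSpan s x -> K x.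
Proof.
move=> HK Ks [a ->]; apply: submodule_sum => // i.
by apply: submodule_mulrz => //; rewrite -tnth_nth.
Qed.

Variable G : V -> Prop.

Lemma generated_submodule_mem x : G x -> generated_submodule G x.
Proof.
move=> Gx; exists 1%N, [tuple x]; split=> [i|]; first by rewrite (tnth_nth 0) ord1.
by exists [ffun=> 1]; rewrite big_ord1 ffunE.
Qed.

Lemma generated_submoduleP : int_submodule (generated_submodule G).
Proof.
split=> [|x y [m [s [Gs [a xE]]]] [m' [s' [Gs' [a' yE]]]]].
  by exists 0%N, [tuple]; split=> [[]//|]; exists [ffun=> 0]; rewrite big_ord0.
exists (m + m')%N, [tuple of s ++ s']; split=> [i|].
  rewrite (tnth_nth 0) /= nth_cat size_tuple; case: ltnP => [im|mi].
    by rewrite -(tnth_nth 0 s (Ordinal im)).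
  have im' : (i - m < m')%N by rewrite ltn_subLR.
  by rewrite -(tnth_nth 0 s' (Ordinal im')).
exists [ffun i => match split i with inl j => a j | inr j => - a' j end].
rewrite big_split_ord /= xE yE -sumrN; congr (_ + _); apply: eq_bigr => i _.
  by rewrite ffunE nth_cat size_tuple ltn_ord (unsplitK (inl i)).
rewrite ffunE nth_cat size_tuple ltnNge leq_addr /= addKn (unsplitK (inr i)).
by rewrite mulrNz.
Qed.

Lemma generated_submodule_ind K x : int_submodule K ->
  (forall y, G y -> K y) -> generated_submodule G x -> K x.
Proof.
move=> HK GK [m [s [Gs]]]; apply: inIntSpan_submodule => // i; exact/GK/Gs.
Qed.

End Submodules.

(** * The lattice and its reductions modulo 2 *)

Lemma intr_Z8_eq0 (z : int) : (z%:~R == 0 :> 'Z_8) = (8 %| z)%Z.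
Proof.
have E (m : nat) : (m%:R == 0 :> 'Z_8) = (8 %| m)%N.
  transitivity (nat_of_ord (m%:R : 'Z_8) == 0%N); first by [].
  by rewrite val_Zp_nat.
by case: z => m; rewrite ?NegzE ?mulrNz ?oppr_eq0 ?dvdzN; exact: E.
Qed.

Section Lattice.
Variables (F : finFieldType) (hF : #|F| = 4%N).
Local Notation point := (proj_point F).
Local Notation n := #|{: point}|.
Local Notation Mdual := {ffun point -> int}.
Implicit Types (P Q : point) (x y z : Mdual) (S : {set point}).

Lemma M_CP x : M_C x <-> exists y z, N_Sigma y /\ x = y + z *+ 8.
Proof.
split=> [[y Ny /ffunP E]|[y [z [Ny ->]]]]; last first.
  exists y => //; apply/ffunP=> P.
  rewrite [LHS]ffunE [RHS]ffunE [(y + _) P]ffunE rmorphD /= ffunMnE rmorphMn /=.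
  by rewrite -mulr_natr (_ : 8 = 0) ?mulr0 ?addr0 //; exact/val_inj.
exists y, [ffun P => ((x P - y P) %/ 8)%Z]; split=> //; apply/ffunP=> P.
have /eqP := E P; rewrite [in X in X -> _]ffunE [X in _ == X -> _]ffunE.
rewrite -subr_eq0 -rmorphB intr_Z8_eq0 => /divzK {}E.
rewrite [RHS]ffunE ffunMnE ffunE -[_ *+ 8]mulr_natr E subrKC; exact: erefl.
Qed.

Lemma M_C_submodule : int_submodule (@M_C F).
Proof.
have HN := generated_submoduleP (@N_generator F); split.
  by apply/M_CP; exists 0, 0; split; [exact: HN.1 | rewrite mul0rn addr0].
move=> x x' /M_CP[y [z [Ny ->]]] /M_CP[y' [z' [Ny' ->]]]; apply/M_CP.
exists (y - y'), (z - z'); split; first exact: HN.2.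
by rewrite mulrnBl addrACA opprD.
Qed.

Lemma M_C_generator x : N_generator x -> M_C x.
Proof.
move=> Gx; apply/M_CP; exists x, 0; split; last by rewrite mul0rn addr0.
exact: generated_submodule_mem.
Qed.

Lemma M_C_mul8 z : M_C (z *+ 8).
Proof.
apply/M_CP; exists 0, z; split; last by rewrite add0r.
exact: (generated_submoduleP _).1.
Qed.

Lemma M_C_ind (K : Mdual -> Prop) : int_submodule K ->
    (forall x, N_generator x -> K x) -> (forall z, K (z *+ 8)) ->
  forall x, M_C x -> K x.
Proof.
move=> HK KG K8 x /M_CP[y [z [Ny ->]]]; apply: submoduleD => //.
exact: generated_submodule_ind Ny.
Qed.

Definition reduction x : 'rV[F]_n := pfun (fun P => (x P)%:~R).

Lemma reductionD x y : reduction (x + y) = reduction x + reduction y.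
Proof. by rewrite -pfunD; apply: eq_pfun => P; rewrite ffunE rmorphD. Qed.

Lemma reductionB x y : reduction (x - y) = reduction x - reduction y.
Proof. by rewrite -pfunB; apply: eq_pfun => P; rewrite !ffunE rmorphB. Qed.

Lemma reductionM2 x m : ~~ odd m -> reduction (x *+ m) = 0.
Proof.
move=> m2; apply/rowP=> j; rewrite !mxE ffunMnE rmorphMn /= -mulr_natr.
by rewrite (natf_odd hF) (negPf m2) mulr0.
Qed.

Lemma set_vectorE S P : set_vector S P = (P \in S)%:Z.
Proof.
rewrite /set_vector sum_ffunE; have [PS|PS] := boolP (P \in S).
  rewrite (bigD1 P) //= ffunE eqxx big1 ?addr0 // => Q /andP[_ QP].
  by rewrite ffunE eq_sym (negPf QP).
rewrite big1 // => Q QS; rewrite ffunE; case: eqP => // PQ.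
by rewrite PQ QS in PS.
Qed.

Lemma reduction_set_vector S : reduction (set_vector S) = indicator S.
Proof. by apply: eq_pfun => P; rewrite set_vectorE; case: (P \in S). Qed.

Lemma M_C_diff k S S' : (k <= 2)%N ->
    S \in subspaces F (3 - k) -> S' \in subspaces F (3 - k) ->
  M_C ((set_vector S - set_vector S') *+ 2 ^ k).
Proof.
move=> k2 Sk Sk'; apply: M_C_generator; exists (3 - k)%N, S, S'; split=> //.
  by lia.
by rewrite subKn //; lia.
Qed.

Lemma reduction_M_C x : M_C x -> (reduction x <= diff_code F 3)%MS.
Proof.
apply: (M_C_ind (K := fun x => reduction x <= diff_code F 3)%MS) => [|y|z].
- split=> [|y z hy hz]; last by rewrite reductionB; exact: submxB.
  by rewrite -(mulr0n 0) reductionM2 // sub0mx.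
- case=> k [S [S' [/andP[k1 k3] Sk Sk' ->]]].
  have [k_lt|k_ge] := ltnP k 3.
    by rewrite reductionM2 ?sub0mx // oddX subn_eq0 orbF -ltnNge.
  have {}k3 : k = 3 by apply/eqP; rewrite eqn_leq k3.
  rewrite k3 in Sk Sk' *.
  by rewrite mulr1n reductionB !reduction_set_vector; exact: diff_codeP.
- by rewrite reductionM2 // sub0mx.
Qed.

Lemma sum_indicator S : \sum_P (P \in S)%:Z = #|S|%:Z.
Proof.
rewrite -sum1_card (big_morph Posz PoszD (erefl 0)) [RHS]big_mkcond.
by apply: eq_bigr => P _; case: (P \in S).
Qed.

Lemma dvd8_sum_M_C x : M_C x -> (8 %| \sum_P x P)%Z.
Proof.
apply: (M_C_ind (K := fun x => 8 %| \sum_P x P)%Z) => [|y|z].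
- split=> [|y z hy hz]; first by rewrite big1 // => P _; rewrite ffunE.
  by under eq_bigr do rewrite !ffunE; rewrite sumrB rpredB.
- case=> k [S [S' [_ Sk Sk' ->]]].
  under eq_bigr do rewrite ffunMnE !ffunE !set_vectorE.
  by rewrite sumrMnl sumrB !sum_indicator // (card_eq_subspaces hF Sk Sk') subrr mul0rn.
- under eq_bigr do rewrite ffunMnE.
  by rewrite sumrMnl -[X in (_ %| X)%Z]mulr_natr dvdz_mull.
Qed.

Definition pairs_through (ss : seq {set point}) : 'rV[F]_n :=
  pfun (fun P => 'C(count (fun S => P \in S) ss, 2)%:R).

(** Two planes meet in a line, or in a plane if they coincide. *)
Lemma binomial_planes_code (ss : seq {set point}) :
    all (fun S => S \in subspaces F 3) ss ->
  (pairs_through ss <= code F 2)%MS.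
Proof.
elim: ss => [_|S ss IHss /= /andP[SP ssP]].
  by rewrite (_ : pairs_through _ = 0) ?sub0mx //; apply/rowP=> j; rewrite !mxE.
rewrite (_ : pairs_through _ = pairs_through ss + \sum_(S' <- ss) indicator (S :&: S')).
  rewrite addmx_sub ?IHss // big_seq; apply: summx_sub => S' S'ss.
  have [s _ ->] := planeP SP; have [t _ ->] := planeP (allP ssP _ S'ss).
  rewrite (_ : indicator _ = ev (zero_form s t)) ?zero_form_code //.
  rewrite -zero_form_pair //; apply: eq_pfun => P; congr (nat_of_bool _)%:R.
  by rewrite !inE tr_col_mx mul_mx_row row_mx_eq0.
apply/rowP=> j; rewrite !mxE summxE; set P := enum_val j.
have -> : \sum_(S' <- ss) indicator (S :&: S') 0 j
    = ((P \in S) * count (fun S => P \in S) ss)%:R :> F.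
  rewrite -sum1_count natrM natr_sum mulr_sumr [RHS]big_mkcond.
  apply: eq_bigr => S' _; rewrite mxE inE -/P.
  by case: (P \in S'); rewrite ?andbT ?andbF ?mulr1.
rewrite -(natrD F); congr _%:R; rewrite /=; case: (P \in S); last by rewrite mul0n addn0.
by rewrite mul1n add1n binS bin1.
Qed.

(** Modulo the multiples [2 y] with [y] reducing to a sum of lines, an element of
    the lattice is a sum of indicators of planes, signs being absorbed by
    [- v = v - 2 v].  If [c] planes pass through a point and [c] is even, then
    [c / 2] has the parity of [c] choose 2, so halving the sum of the planes
    gives the sum of their pairwise intersections. *)
Lemma half_reduction_M_C x : M_C (x *+ 2) -> (reduction x <= code F 2)%MS.
Proof.
pose K (x : Mdual) := exists (ss : seq {set point}) y,
  [/\ all (fun S => S \in subspaces F 3) ss, (reduction y <= code F 2)%MS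
    & x = \sum_(S <- ss) set_vector S + y *+ 2].
have K2 y : (reduction y <= code F 2)%MS -> K (y *+ 2).
  by move=> Hy; exists [::], y; rewrite big_nil add0r.
have plane S : S \in subspaces F 3 -> (reduction (set_vector S) <= code F 2)%MS.
  case/planeP=> s _ ->.
  by rewrite reduction_set_vector zero_form_single // zero_form_code.
have planes ss : all (fun S => S \in subspaces F 3) ss ->
    (reduction (\sum_(S <- ss) set_vector S)%R <= code F 2)%MS.
  elim: ss => [_|S ss IHss /= /andP[SP ssP]].
    by rewrite big_nil -(mulr0n 0) reductionM2 // sub0mx.
  by rewrite big_cons reductionD addmx_sub ?plane ?IHss.
have HK : int_submodule K.
  split=> [|_ _ [ss [y [ssP Hy ->]]] [ss' [y' [ssP' Hy' ->]]]].
    by rewrite -(mul0rn _ 2); apply: K2; rewrite -(mulr0n 0) reductionM2 // sub0mx.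
  exists (ss ++ ss'), (y - y' - \sum_(S <- ss') set_vector S); split.
  - by rewrite all_cat ssP.
  - by rewrite reductionB reductionB !submxB // planes.
  - rewrite big_cat /= !mulrnBl; move: (\sum_(S <- ss) _) (\sum_(S <- ss') _).
    by move=> a b; apply/ffunP=> P; rewrite !ffunE; ring.
move=> /(M_C_ind HK)[||ss [y [ssP Hy xE]]].
- move=> _ [k [S [S' [/andP[k1 k3] Sk Sk' ->]]]].
  case: k k1 k3 Sk Sk' => [|[|[|[|]]]] // _ _ Sk Sk'.
  + rewrite (mulrnA _ 2 2); apply: K2.
    by rewrite reductionM2 // sub0mx.
  + apply: K2; rewrite reductionB !reduction_set_vector.
    by rewrite submxB // indicator_code.
  rewrite mulr1n; exists [:: S; S'], (- set_vector S'); split.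
  - by rewrite /= Sk Sk'.
  - by rewrite -sub0r reductionB submxB ?plane // -(mulr0n 0) reductionM2 // sub0mx.
  - by rewrite !big_cons big_nil; apply/ffunP=> P; rewrite !ffunE; ring.
- by move=> z; rewrite (mulrnA _ 4 2); apply: K2; rewrite reductionM2 // sub0mx.
rewrite (_ : reduction x = pairs_through ss + reduction y); first
  by rewrite addmx_sub // binomial_planes_code.
rewrite -pfunD; apply: eq_pfun => P.
have : x P *+ 2 = (count (fun S => P \in S) ss)%:Z + y P *+ 2.
  rewrite -!ffunMnE xE ffunE; congr (_ + _).
  elim: (ss) => [|S ss' IHss]; first by rewrite big_nil ffunE.
  by rewrite big_cons ffunE IHss set_vectorE.
move: (count _ ss) => c xyP.
have [m cE xE'] : exists2 m : nat, c = m.*2 & x P = m%:Z + y P.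
  exists c./2; lia.
rewrite xE' cE rmorphD /=; congr (_ + _).
rewrite [LHS](natf_odd hF) [RHS](natf_odd hF) bin2 -doubleMl half_double oddM.
by case: m {cE xE'} => // m; rewrite doubleS /= odd_double andbT.
Qed.

Lemma coord_sum_reduction x m : (0 < m)%N -> (2 * m %| 8)%N -> M_C (x *+ m) ->
  coord_sum (reduction x) = 0.
Proof.
move=> m0 m8 Mx; have x2 : (2 %| \sum_P x P)%Z.
  have := dvd8_sum_M_C Mx; under eq_bigr do rewrite ffunMnE.
  rewrite sumrMnl -[X in (_ %| X)%Z -> _]mulr_natr natz => h.
  rewrite -(@dvdz_mul2r m%:Z) -?lt0n // -PoszM; apply: dvdz_trans h.
  by rewrite dvdzE.
have /eqP : (\sum_P x P)%:~R == 0 :> F by rewrite (intf_eq0 hF).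
rewrite coord_sumE rmorph_sum /= -(@sum_enum_val F F (fun P => (x P)%:~R)) => E.
by rewrite -[RHS]E; apply: eq_bigr => j _; rewrite mxE.
Qed.

Lemma reduction_M_C2 x : M_C (x *+ 2) -> (reduction x <= diff_code F 2)%MS.
Proof.
move=> x2; apply: code_coord_sum0 => //; first exact: half_reduction_M_C.
exact: coord_sum_reduction x2.
Qed.

Lemma reduction_M_C4 x : M_C (x *+ 4) -> (reduction x <= diff_code F 1)%MS.
Proof.
move=> x4; apply: code_coord_sum0 => //; first exact: point_code_full.
exact: coord_sum_reduction x4.
Qed.

End Lattice.


(** * Integer submodules containing the multiples of 8 *)

(** Both this matrix and its complement, whose sum is the identity, have rank at
    most their number of non-zero entries. *)
Lemma rank_diag_bool (F : fieldType) n (p : pred 'I_n) :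
  \rank (diag_mx (\row_j (p j)%:R) : 'M[F]_n) = #|p|.
Proof.
pose D (q : pred 'I_n) : 'M[F]_n := diag_mx (\row_j (q j)%:R).
have le q : (\rank (D q) <= #|q|)%N.
  rewrite (_ : D q = \sum_(j | q j) delta_mx j j); last first.
    apply/matrixP=> i j; rewrite summxE !mxE.
    have [->|ij] := eqVneq i j; last first.
      rewrite mulr0n big1 // => k _; rewrite mxE.
      by case: eqP => //= <-; rewrite eq_sym (negPf ij).
    rewrite mulr1n; have [qj|qj] := boolP (q j).
      rewrite (bigD1 j) //= mxE !eqxx big1 ?addr0 // => k /andP[_ kj].
      by rewrite mxE eq_sym (negPf kj).
    by rewrite big1 // => k qk; rewrite mxE; case: eqP => // jk; rewrite jk qk in qj.
  rewrite -sum1_card; elim/big_rec2: _ => [|j r A _ rA]; first by rewrite mxrank0.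
  by apply: leq_trans (mxrank_add _ _) _; rewrite mxrank_delta leq_add2l.
apply/eqP; rewrite eqn_leq le /= -(leq_add2r #|predC p|) cardC card_ord.
rewrite -{1}(mxrank1 F n) (_ : 1%:M = D p + D (predC p)).
  by apply: leq_trans (mxrank_add _ _) _; rewrite leq_add2l le.
apply/matrixP=> i j; rewrite !mxE -mulrnDl /=.
by case: (p i); rewrite /= ?addr0 ?add0r.
Qed.

Section Smith.
Variables (n : nat) (L : 'rV[int]_n -> Prop).

(** Smith normal form: the elementary divisors divide 8 because the submodule
    contains the multiples of 8. *)
Lemma smith_exponents m (M : 'M[int]_(m, n)) :
    (forall x, L x <-> exists a : 'rV_m, x = a *m M) ->
    (forall x, L (x *+ 8)) ->
  exists (R : 'M[int]_n) (e : 'I_n -> nat),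
    [/\ R \in unitmx, forall j, (e j <= 3)%N
      & forall x, L x <-> forall j, (2 ^+ e j %| ((x *m invmx R) 0 j)%R)%Z].
Proof.
move=> LM L8; have [U Uu [R Ru [d _ ME]]] := int_Smith_normal_form M.
pose D := \matrix_(i < m, j < n) (d`_i *+ (i == j :> nat)) : 'M[int]_(m, n).
have LD x : L x <-> exists a, x *m invmx R = a *m D.
  rewrite LM ME; split=> [[a ->]|[a xE]].
    by exists (a *m U); rewrite !mulmxA mulmxK.
  by exists (a *m invmx U); rewrite -(mulmxKV Ru x) xE !mulmxA mulmxKV.
(* M may have fewer rows than columns; the missing elementary divisors are 0. *)
pose c (j : 'I_n) := if (j < m)%N then d`_j else 0.
have aD (a : 'rV_m) j : (c j %| ((a *m D) 0 j)%R)%Z.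
  rewrite mxE; apply: rpred_sum => i _.
  rewrite mxE /c; case: eqP => [<-|_]; last by rewrite mulr0n mulr0 dvdz0.
  by rewrite ltn_ord mulr1n dvdz_mull.
have Lc x : L x <-> forall j, (c j %| ((x *m invmx R) 0 j)%R)%Z.
  rewrite LD; split=> [[a ->] j //|Hx].
  exists (\row_i (if insub (val i) is Some j
    then (((x *m invmx R) 0 j)%R %/ d`_i)%Z else 0)).
  apply/rowP=> j; rewrite [RHS]mxE; have := Hx j; rewrite /c.
  have [jm|mj] := ltnP j m => dj.
    rewrite (bigD1 (Ordinal jm)) //= [X in _ = X * _ + _]mxE [D _ _]mxE /=.
    rewrite (valK j) eqxx mulr1n divzK //.
    rewrite big1 ?addr0 // => i; rewrite -(inj_eq val_inj) /= => /negPf ij.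
    by rewrite !mxE ij mulr0.
  rewrite big1 => [|i _]; first by move: dj; rewrite dvd0z => /eqP.
  rewrite !mxE (_ : (val i == j) = false) ?mulr0n ?mulr0 //.
  by apply/negbTE; rewrite neq_ltn (leq_trans (ltn_ord i) mj).
have c8 j : (c j %| 8)%Z.
  have /Lc/(_ j) := L8 (row j R).
  by rewrite -scaler_nat -scalemxAl -row_mul mulmxV // !mxE eqxx mulr1.
pose e j := logn 2 `|c j|%N.
have ce j : `|c j|%N = (2 ^ e j)%N.
  have : (`|c j| %| 2 ^ 3)%N by have := c8 j; rewrite dvdzE.
  by case/(dvdn_pfactor _ _ (isT : prime 2)) => k _ ckE; rewrite /e ckE pfactorK.
exists R, e; split=> // [j|x].
  by rewrite -(@leq_exp2l 2) // -ce; apply: dvdn_leq => //; have := c8 j; rewrite dvdzE.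
rewrite Lc; have E j z : (2 ^+ e j %| z)%Z = (c j %| z)%Z.
  by rewrite !dvdzE abszX ce.
by split=> h j; move: (h j); rewrite E.
Qed.

(** Modulo 2 and in the basis [R], the elements [x] with [2 ^ k x] in the
    submodule are those supported on the [j] with [e j <= k]: at the other
    places the coordinates are even. *)
Lemma rank_filtration (F : fieldType) (R : 'M[int]_n) (e : 'I_n -> nat) k p
    (E : 'M[F]_(p, n)) :
    (forall z : int, (z%:~R == 0 :> F) = (2 %| z)%Z) ->
    R \in unitmx ->
    (forall x, L x <-> forall j, (2 ^+ e j %| ((x *m invmx R) 0 j)%R)%Z) ->
    (forall x, L (x *+ 2 ^ k) -> (map_mx intr x <= E)%MS) ->
    (forall A : 'M[F]_n,
       (forall x, L (x *+ 2 ^ k) -> (map_mx intr x <= A)%MS) -> (E <= A)%MS) ->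
  \rank E = #|[pred j | (e j <= k)%N]|.
Proof.
move=> F2 Ru Le LE Emin.
pose D : 'M[F]_n := diag_mx (\row_j (e j <= k)%N%:R).
pose Rb : 'M[F]_n := map_mx intr R.
have /mulmx1_unit[Rbu _] : Rb *m map_mx intr (invmx R) = 1%:M.
  by rewrite -map_mxM mulmxV // map_mx1.
rewrite -(rank_diag_bool F); transitivity (\rank (D *m Rb)); last first.
  by rewrite mxrankMfree // row_free_unit.
apply/eqmx_rank/andP; split.
  apply: Emin => x /Le Lx.
  have {Lx} Ly j : (2 ^+ e j %| (2 ^+ k * (x *m invmx R) 0 j)%R)%Z.
    by have := Lx j; rewrite -scaler_nat -scalemxAl mxE natrX.
  rewrite -(mulmxKV Ru x) map_mxM -/Rb; move: (x *m invmx R) Ly => y Ly.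
  rewrite (_ : map_mx intr y = map_mx intr y *m D); first by rewrite -mulmxA submxMl.
  rewrite mul_mx_diag; apply/rowP=> j; rewrite !mxE.
  case: leqP => [_|kj]; first by rewrite mulr1.
  rewrite mulr0; apply/eqP; rewrite F2; move: (Ly j).
  rewrite -(subnKC (ltnW kj)) exprD dvdz_mul2l ?expf_neq0 // => h.
  by apply: dvdz_trans h; rewrite -[X in (X %| _)%Z]expr1 dvdz_exp2l // subn_gt0.
apply/row_subP=> j; rewrite row_mul row_diag_mx mxE -scalemxAl -rowE.
case: leqP => [jk|_]; last by rewrite scale0r sub0mx.
rewrite scale1r -map_row; apply/LE/Le => i.
rewrite -scaler_nat -scalemxAl -row_mul mulmxV // !mxE natrX.
by case: eqP => [<-|_]; rewrite ?mulr0 ?dvdz0 // mulr1 dvdz_exp2l.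
Qed.

End Smith.

(** * A basis of the lattice *)

Section Basis.
Variables (F : finFieldType) (hF : #|F| = 4%N).
Local Notation point := (proj_point F).
Local Notation n := #|{: point}|.
Local Notation Mdual := {ffun point -> int}.
Implicit Types (P Q : point) (x y z : Mdual) (S : {set point}).

Definition vec x : 'rV[int]_n := \row_j x (enum_val j).
Definition unvec (r : 'rV[int]_n) : Mdual := [ffun P => r 0 (enum_rank P)].

Lemma vecK : cancel vec unvec.
Proof. by move=> x; apply/ffunP=> P; rewrite ffunE mxE enum_rankK. Qed.

Lemma unvecK : cancel unvec vec.
Proof. by move=> r; apply/rowP=> j; rewrite mxE ffunE enum_valK. Qed.

Lemma vec_is_zmod_morphism : zmod_morphism vec.
Proof. by move=> x y; apply/rowP=> j; rewrite !mxE !ffunE. Qed.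
HB.instance Definition _ := GRing.isZmodMorphism.Build _ _ vec vec_is_zmod_morphism.

Lemma unvec_is_zmod_morphism : zmod_morphism unvec.
Proof. by move=> r s; apply/ffunP=> P; rewrite !ffunE !mxE. Qed.
HB.instance Definition _ := GRing.isZmodMorphism.Build _ _ unvec unvec_is_zmod_morphism.

Lemma map_vec x : map_mx intr (vec x) = reduction x.
Proof. by apply/rowP=> j; rewrite !mxE. Qed.

Definition subspace_differences (k : nat) : seq Mdual :=
  [seq (set_vector A - set_vector B) *+ 2 ^ (3 - k)
     | A <- enum (subspaces F k), B <- enum (subspaces F k)].

Definition M_C_generators : seq Mdual :=
  flatten [seq subspace_differences k | k <- iota 1 3]
    ++ [seq basis_vector P *+ 8 | P <- enum {: point}].

Lemma M_C_generator_matrix :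
  exists m (M : 'M[int]_(m, n)), forall x, M_C x <-> exists a, vec x = a *m M.
Proof.
pose G := M_C_generators; pose M := \matrix_(i < size G) vec (nth 0 G i).
exists (size G), M => x; split.
  have HK : int_submodule (fun x => exists a, vec x = a *m M).
    split=> [|y z [a ya] [b zb]]; first by exists 0; rewrite raddf0 mul0mx.
    by exists (a - b); rewrite raddfB /= ya zb mulmxBl.
  have HG y : y \in G -> exists a, vec y = a *m M.
    rewrite -index_mem => yG; exists (delta_mx 0 (Ordinal yG)).
    by rewrite -rowE rowK nth_index // -index_mem.
  apply: (M_C_ind HK) => [y [k [S [S' [/andP[k1 k3] Sk Sk' ->]]]]|z].
    apply: HG; rewrite mem_cat; apply/orP; left; apply/flattenP.
    exists (subspace_differences k); first by rewrite map_f // mem_iota k1.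
    by apply: (allpairs_f (fun S S' => (set_vector S - set_vector S') *+ 2 ^ (3 - k)));
      rewrite mem_enum.
  rewrite (_ : z *+ 8 = \sum_P (basis_vector P *+ 8) *~ z P).
    apply: (submodule_sum _ HK) => P; apply: (submodule_mulrz _ HK); apply: HG.
    by rewrite mem_cat; apply/orP; right; apply/map_f; rewrite mem_enum.
  apply/ffunP=> P; rewrite sum_ffunE (bigD1 P) //= big1 => [|Q QP].
    by rewrite addr0 ffunMzE !ffunMnE ffunE eqxx -mulrzl intz mulr_natr.
  by rewrite ffunMzE ffunMnE ffunE eq_sym (negPf QP) !mul0rn mul0rz.
case=> a xa; rewrite -(vecK x) xa mulmx_sum_row raddf_sum.
have HM := M_C_submodule F.
apply: (submodule_sum _ HM) => i; rewrite rowK /=.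
rewrite (_ : unvec _ = nth 0 G i *~ a 0 i).
  apply: (submodule_mulrz _ HM).
  have : nth 0 G i \in G by exact: mem_nth.
  rewrite mem_cat => /orP[|/mapP[P _ ->]]; last exact: M_C_mul8.
  case/flattenP=> _ /mapP[k k13 ->] /allpairsP[[S S'] [/=]].
  rewrite !mem_enum => Sk Sk' ->; apply: M_C_generator; exists k, S, S'; split=> //.
  by move: k13; rewrite mem_iota.
by rewrite -{2}(vecK (nth 0 G i)) -raddfMz /= -scaler_int intz.
Qed.

Theorem M_C_basis_matrix : exists B : 'M[int]_n,
  (forall x, M_C x <-> exists a, vec x = a *m B) /\ \det B ^+ 2 = 2 ^+ 190.
Proof.
have [m [M HM]] := M_C_generator_matrix.
pose L (r : 'rV[int]_n) := M_C (unvec r).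
have LM r : L r <-> exists a, r = a *m M by rewrite /L HM unvecK.
have L8 r : L (r *+ 8) by rewrite /L raddfMn; exact: M_C_mul8.
have [R [e [Ru e3 Le]]] := smith_exponents LM L8.
pose B : 'M[int]_n := diag_mx (\row_j 2 ^+ e j) *m R.
exists B; split=> [x|].
  rewrite -{1}(vecK x) -/(L (vec x)) Le; split=> [H|[a ->] j].
    exists (\row_j (((vec x *m invmx R) 0 j)%R %/ 2 ^+ e j)%Z).
    rewrite mulmxA -[LHS](mulmxKV Ru); congr (_ *m _); rewrite mul_mx_diag.
    by apply/rowP=> j; rewrite [RHS]mxE [X in _ = X * _]mxE [X in _ = _ * X]mxE divzK.
  by rewrite mulmxA mulmxK // mul_mx_diag mxE [X in (_ %| _ * X)%Z]mxE dvdz_mull.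
rewrite det_mulmx det_diag exprMn.
have -> : \det R ^+ 2 = 1.
  have /orP[/eqP->|/eqP->] : (\det R == 1) || (\det R == -1).
    by move: Ru; rewrite unitmxE.
  - exact: expr1n.
  - by rewrite sqrrN expr1n.
rewrite mulr1; under eq_bigr do rewrite mxE.
rewrite prodrXr -exprM; congr (_ ^+ _).
have rk k : (k < 3)%N -> \rank (diff_code F (3 - k)) = #|[pred j | (e j <= k)%N]|.
  move=> k3; apply: (rank_filtration (intf_eq0 hF) Ru Le) => [r|A HA].
    rewrite /L raddfMn /= -[r in map_mx _ r]unvecK map_vec.
    case: k k3 => [|[|[|]]] // _.
    - exact: reduction_M_C.
    - exact: reduction_M_C2.
    - exact: reduction_M_C4.
  apply: diff_code_sub => S S' Sk Sk'.
  rewrite -!reduction_set_vector -reductionB -map_vec; apply: HA.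
  by rewrite /L raddfMn /= vecK; apply: M_C_diff; rewrite // -ltnS.
(* Each e j is at most 3, so e j and the number of k < 3 with e j <= k sum to 3. *)
have sum_e : (\sum_j e j + (16 + 60 + 84) = 3 * n)%N.
  have := rk 0%N isT; have := rk 1%N isT; have := rk 2%N isT.
  rewrite (rank_plane_diff_code hF) (rank_line_diff_code hF) (rank_point_diff_code hF).
  have -> : (3 * n = \sum_(j < n) 3)%N by rewrite sum_nat_const card_ord mulnC.
  have cardE (q : pred 'I_n) : #|q| = (\sum_j q j)%N.
    rewrite -sum1_card big_mkcond; apply: eq_bigr => j _.
    by rewrite unfold_in; case: (q j).
  move=> -> -> ->; rewrite !cardE -!big_split /=.
  by apply: eq_bigr => j _; have := e3 j; case: (e j) => [|[|[|[|]]]].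
by have := card_points hF; move: sum_e; lia.
Qed.

End Basis.

(** * Independence of the discriminant from the basis *)

Section Discriminant.
Variables (F : finFieldType) (hF : #|F| = 4%N).
Local Notation point := (proj_point F).
Local Notation n := #|{: point}|.
Local Notation Mdual := {ffun point -> int}.
Implicit Types (P Q : point) (x y z : Mdual) (S : {set point}).

Definition tuple_mx k (s : k.-tuple Mdual) : 'M[int]_(k, n) :=
  \matrix_(i < k) vec (tnth s i).

Lemma vec_lincomb k (s : k.-tuple Mdual) (a : 'I_k -> int) :
  vec (\sum_i tnth s i *~ a i) = (\row_i a i) *m tuple_mx s.
Proof.
rewrite raddf_sum mulmx_sum_row; apply: eq_bigr => i _ /=.
by rewrite raddfMz /= rowK mxE -scaler_int intz.
Qed.

Lemma inIntSpanP k (s : k.-tuple Mdual) x :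
  inIntSpan s x <-> exists a, vec x = a *m tuple_mx s.
Proof.
split=> [[a ->]|[a xa]].
  exists (\row_i a i); rewrite -vec_lincomb; congr vec.
  by apply: eq_bigr => i _; rewrite (tnth_nth 0).
exists [ffun i => a 0 i]; apply: (can_inj (@vecK F)); rewrite xa.
rewrite (_ : \sum_(i < k) _ = \sum_i tnth s i *~ a 0 i).
  by rewrite vec_lincomb; congr (_ *m _); apply/rowP=> i; rewrite mxE.
by apply: eq_bigr => i _; rewrite ffunE (tnth_nth 0).
Qed.

Lemma int_basisP (L : Mdual -> Prop) k (s : k.-tuple Mdual) :
  int_basis L s <-> (forall x, L x <-> exists a, vec x = a *m tuple_mx s)
    /\ (forall a : 'rV_k, a *m tuple_mx s = 0 -> a = 0).
Proof.
split=> [[Ls s0]|[Ls s0]]; split=> [x|a].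
- by rewrite Ls inIntSpanP.
- move=> as0; apply/rowP=> i; rewrite mxE; apply: (s0 (fun i => a 0 i)).
  apply: (can_inj (@vecK F)); rewrite vec_lincomb raddf0 -[RHS]as0; congr (_ *m _).
  by apply/rowP=> j; rewrite mxE.
- by rewrite Ls inIntSpanP.
- move=> /(congr1 (@vec F)); rewrite vec_lincomb raddf0 => /s0/rowP a0 i.
  by have := a0 i; rewrite !mxE.
Qed.

Lemma gram_tuple_mx k (s : k.-tuple Mdual) :
  gram (@dual_form F) s = 4^-1 *: map_mx intr (tuple_mx s *m (tuple_mx s)^T).
Proof.
apply/matrixP=> i j; rewrite !mxE rmorph_sum mulr_sumr -[LHS]sum_enum_val.
by apply: eq_bigr => l _; rewrite !mxE rmorphM mulrC.
Qed.

Lemma mx_span_lift k l (A : 'M[int]_(k, n)) (C : 'M[int]_(l, n)) :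
    (forall x : 'rV_n, (exists a, x = a *m A) -> exists a, x = a *m C) ->
  exists T, A = T *m C.
Proof.
move=> AC; have /fin_all_exists[f fE] i : exists a, row i A = a *m C.
  by apply: AC; exists (delta_mx 0 i); rewrite -rowE.
by exists (\matrix_i f i); apply/row_matrixP=> i; rewrite row_mul rowK.
Qed.

(** Two bases of a lattice are expressed in each other by mutually inverse
    integer matrices, of determinant 1 or -1. *)
Lemma int_basis_det (B : 'M[int]_n) k (A : 'M[int]_(k, n)) :
    (forall x : 'rV_n, (exists a, x = a *m A) <-> exists a, x = a *m B) ->
    (forall a : 'rV_k, a *m A = 0 -> a = 0) -> \det B != 0 ->
  k = n /\ \det (A *m A^T) = \det B ^+ 2.
Proof.
move=> AB A0 B0; have [T AE] := mx_span_lift (fun r => proj1 (AB r)).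
have [U BE] := mx_span_lift (fun r => proj2 (AB r)).
have TU : T *m U = 1%:M.
  apply/subr0_eq/row_matrixP=> i; rewrite row0; apply: A0.
  by rewrite -row_mul mulmxBl mul1mx -mulmxA -BE -AE subrr row0.
have UT : U *m T = 1%:M.
  have E : (U *m T - 1%:M) *m B = 0.
    by rewrite mulmxBl mul1mx -mulmxA -AE -BE subrr.
  have := congr1 (mulmx^~ (\adj B)) E.
  rewrite -mulmxA mul_mx_adj mul0mx mul_mx_scalar => /eqP.
  by rewrite scalemx_eq0 (negPf B0) subr_eq0 => /eqP.
have kn : k = n by apply/eqP; rewrite eqn_leq (mulmx1_min TU) (mulmx1_min UT).
split=> //; subst k; rewrite det_mulmx det_tr AE det_mulmx -expr2 exprMn.
have /orP[/eqP->|/eqP->] : (\det T == 1) || (\det T == -1).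
  by have [Tu _] := mulmx1_unit TU; move: Tu; rewrite unitmxE.
- by rewrite expr1n mul1r.
- by rewrite sqrrN expr1n mul1r.
Qed.

Lemma discriminant_from_matrix (L : Mdual -> Prop) (B : 'M[int]_n) :
    (forall x, L x <-> exists a, vec x = a *m B) -> \det B != 0 ->
  has_rank L n /\
  has_discriminant (@dual_form F) L ((\det B ^+ 2)%:~R / 4 ^+ n).
Proof.
move=> LB B0; pose s : n.-tuple Mdual := [tuple unvec (row i B) | i < n].
have sE : tuple_mx s = B.
  by apply/row_matrixP=> i; rewrite rowK tnth_mktuple unvecK.
have sB : int_basis L s.
  apply/int_basisP; rewrite sE; split=> // a aB.
  have := congr1 (mulmx^~ (\adj B)) aB.
  rewrite -mulmxA mul_mx_adj mul0mx mul_mx_scalar => /eqP.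
  by rewrite scalemx_eq0 (negPf B0) => /eqP.
split; first by exists s.
split=> [|k t /int_basisP[Lt t0]]; first by exists n, s.
have [|kn detE] := int_basis_det _ t0 B0.
  by move=> x; rewrite -(unvecK x) -Lt LB.
rewrite gram_tuple_mx detZ det_map_mx detE kn /= mulrC.
congr (_ * _); exact: exprVn.
Qed.

End Discriminant.

(** * Integrality and evenness *)

Section Integrality.
Variables (F : finFieldType) (hF : #|F| = 4%N).
Local Notation point := (proj_point F).
Local Notation n := #|{: point}|.
Local Notation Mdual := {ffun point -> int}.
Implicit Types (P Q : point) (x y z : Mdual) (S T : {set point}).

Definition int_form x y : int := \sum_P x P * y P.

Lemma dual_formE x y : dual_form x y = (int_form x y)%:~R / 4.
Proof. by rewrite rmorph_sum mulr_suml; apply: eq_bigr => P _; rewrite rmorphM. Qed.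

Lemma int_formC x y : int_form x y = int_form y x.
Proof. by apply: eq_bigr => P _; rewrite mulrC. Qed.

Lemma int_formBl x y z : int_form (x - y) z = int_form x z - int_form y z.
Proof. by rewrite -sumrB; apply: eq_bigr => P _; rewrite !ffunE mulrBl. Qed.

Lemma int_formBr x y z : int_form z (x - y) = int_form z x - int_form z y.
Proof. by rewrite int_formC int_formBl !(int_formC z). Qed.

Lemma int_formMl x y m : int_form (x *+ m) y = int_form x y * m%:Z.
Proof.
rewrite mulr_suml; apply: eq_bigr => P _.
by rewrite ffunMnE mulrnAl -mulr_natr natz.
Qed.

Lemma int_formMr x y m : int_form x (y *+ m) = int_form x y * m%:Z.
Proof. by rewrite int_formC int_formMl int_formC. Qed.

Lemma int_form_set S T : int_form (set_vector S) (set_vector T) = #|S :&: T|%:Z.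
Proof.
rewrite -sum_indicator; apply: eq_bigr => P _.
by rewrite !set_vectorE inE; case: (P \in S); case: (P \in T).
Qed.

(** Subspaces of total dimension at least 5 in a 4-dimensional space meet, and
    the number [(4 ^ r - 1) / 3] of points of their intersection is 1 mod 4. *)
Lemma card_subspaceI k l S T : (5 <= k + l)%N ->
  S \in subspaces F k -> T \in subspaces F l -> (#|S :&: T| = 1 %[mod 4])%N.
Proof.
move=> kl /imsetP[U]; rewrite inE => /eqP rU -> /imsetP[V]; rewrite inE => /eqP rV ->.
have -> : linear_set U :&: linear_set V = linear_set (U :&: V)%MS.
  by apply/setP=> P; rewrite inE !in_linear_set sub_capmx.
have r_gt0 : (0 < \rank (U :&: V))%N.
  have := mxrank_sum_cap U V; have := rank_leq_col (U + V)%MS; lia.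
have := card_linear_set (U :&: V)%MS; rewrite hF /= -(prednK r_gt0) expnS.
move: (4 ^ _)%N (expn_gt0 4 (\rank (U :&: V)).-1); lia.
Qed.

(** For small [k + l] the coefficients provide the factor 4; otherwise it comes
    from the cancellation of four intersections with 1 point modulo 4. *)
Lemma int_form_generators x y : N_generator x -> N_generator y ->
  (4 %| int_form x y)%Z.
Proof.
move=> [k [S [S' [/andP[k1 k3] Sk Sk' ->]]]] [l [T [T' [/andP[l1 l3] Tl Tl' ->]]]].
rewrite int_formMl int_formMr !int_formBl !int_formBr !int_form_set.
have [kl|kl] := leqP 5 (k + l).
  apply/dvdz_mulr/dvdz_mulr.
  have := card_subspaceI kl Sk Tl; have := card_subspaceI kl Sk Tl'.
  have := card_subspaceI kl Sk' Tl; have := card_subspaceI kl Sk' Tl'.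
  lia.
rewrite -mulrA; apply: dvdz_mull; rewrite -PoszM -expnD.
by rewrite dvdzE /=; apply: (@dvdn_exp2l 2 2); lia.
Qed.

Lemma int_form_M_C x y : M_C x -> M_C y -> (4 %| int_form x y)%Z.
Proof.
have HK z : int_submodule (fun x => 4 %| int_form x z)%Z.
  split=> [|u v hu hv]; last by rewrite int_formBl rpredB.
  by rewrite -(mulr0n 0) int_formMl mulr0.
move=> Mx My; move: x Mx.
apply: (M_C_ind (HK y)) => [x Gx|z]; last first.
  by rewrite int_formMl dvdz_mull.
rewrite int_formC; move: y My; apply: (M_C_ind (HK x)) => [y Gy|z].
  exact: int_form_generators.
by rewrite int_formMl dvdz_mull.
Qed.

Lemma int_norm_generator x : N_generator x -> (8 %| int_form x x)%Z.
Proof.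
move=> [k [S [S' [/andP[k1 k3] Sk Sk' ->]]]].
rewrite int_formMl int_formMr int_formBl !int_formBr !int_form_set !setIid.
rewrite [S' :&: S]setIC (card_eq_subspaces hF Sk Sk').
case: k k1 k3 Sk Sk' => [|[|[|[|]]]] // _ _ Sk Sk'.
- by rewrite (_ : 2 ^ (3 - 1) = 4)%N //; lia.
- by rewrite (_ : 2 ^ (3 - 2) = 2)%N //; lia.
have le5 : (5 <= 3 + 3)%N by [].
rewrite (_ : 2 ^ (3 - 3) = 1)%N //; have := card_subspaceI le5 Sk Sk'.
by have := card_subspaceI le5 Sk' Sk'; rewrite setIid; lia.
Qed.

Lemma int_norm_M_C x : M_C x -> (8 %| int_form x x)%Z.
Proof.
move=> Mx; suff [] : M_C x /\ (8 %| int_form x x)%Z by [].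
move: x Mx; apply: M_C_ind => [|x Gx|z].
- split=> [|x y [Mx hx] [My hy]].
    split; first exact: (M_C_submodule F).1.
    by rewrite -(mulr0n 0) int_formMl mulr0.
  split; first exact: (M_C_submodule F).2.
  rewrite int_formBl !int_formBr (int_formC y x).
  have := int_form_M_C Mx My; lia.
- by split; [exact: M_C_generator | exact: int_norm_generator].
- by split; [exact: M_C_mul8 | rewrite int_formMl dvdz_mull].
Qed.

End Integrality.

(** * Weights of Hermitian forms *)

Section Hermitian.
Variables (F : finFieldType) (hF : #|F| = 4%N).
Local Notation vec := 'rV[F]_4.
Implicit Types (u v w s : vec) (a b : F).

Definition hermitian (ss : seq vec) u v : F := \sum_(s <- ss) dot u s * dot v s ^+ 2.

Definition hermitian_norm (ss : seq vec) v : F := \sum_(s <- ss) norm_form s v.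

Variable ss : seq vec.
Local Notation B := (hermitian ss).
Local Notation h := (hermitian_norm ss).

Lemma hermitian_diag v : h v = B v v.
Proof. by apply: eq_bigr => s _; rewrite /norm_form exprS. Qed.

Lemma hermitianDl u v w : B (u + v) w = B u w + B v w.
Proof. by rewrite -big_split; apply: eq_bigr => s _ /=; rewrite dotDl mulrDl. Qed.

Lemma hermitianZl a u v : B (a *: u) v = a * B u v.
Proof. by rewrite mulr_sumr; apply: eq_bigr => s _; rewrite dotZl mulrA. Qed.

Lemma hermitian_sym u v : B v u = B u v ^+ 2.
Proof.
rewrite (sumf_sqr hF); apply: eq_bigr => s _.
by rewrite exprMn -exprM (expf4 hF) mulrC.
Qed.

Lemma hermitianDr u v w : B w (u + v) = B w u + B w v.
Proof.
rewrite -big_split; apply: eq_bigr => s _ /=.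
by rewrite dotDl sqrrD mulr2n (addf_self hF) addr0 mulrDr.
Qed.

Lemma hermitianZr u v a : B u (a *: v) = a ^+ 2 * B u v.
Proof. by rewrite hermitian_sym hermitianZl exprMn -hermitian_sym. Qed.

(** Completing the square along the line directed by [u]. *)
Lemma hermitian_norm_line u v a : h u = 1 ->
  h (v + a *: u) = (h v + B u v ^+ 3) + (a + B u v ^+ 2) ^+ 3.
Proof.
move=> hu; rewrite hermitian_diag hermitianDl !hermitianDr !hermitianZl !hermitianZr.
rewrite -!hermitian_diag hu (hermitian_sym u v); move: (B u v) (h v) => b c.
have -> : (a + b ^+ 2) ^+ 3 = a ^+ 3 + a ^+ 2 * b ^+ 2 + a * b + b ^+ 3.
  rewrite exprS sqrrD mulr2n (addf_self hF) addr0 -exprM (expf4 hF).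
  by ring.
by rewrite -[LHS]addr0 -(addf_self hF (b ^+ 3)); ring.
Qed.

Lemma sum_translate (V : finZmodType) (G : V -> nat) t :
  (\sum_v G (v + t)%R = \sum_v G v)%N.
Proof. by rewrite [RHS](reindex_inj (addIr t)). Qed.

Lemma sum_cubes (G : F -> nat) : (\sum_a G (a ^+ 3)%R = G 0%R + 3 * G 1%R)%N.
Proof.
rewrite (bigD1 0) //= expr0n; congr (_ + _)%N.
rewrite (eq_bigr (fun=> G 1)) => [|a a0]; last by rewrite (expf3 hF) a0.
by rewrite sum_nat_const (cardC1 0) hF.
Qed.

Lemma hermitian_norm01 v : h v = 0 \/ h v = 1.
Proof.
have : h v ^+ 2 = h v by rewrite hermitian_diag -hermitian_sym.
move/eqP; rewrite -subr_eq0 exprS -[X in _ - X]mulr1 -mulrBr mulf_eq0 subr_eq0.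
by case/orP=> /eqP; [left | right].
Qed.

(** Let [h u = 1].  If [h] vanishes on the orthogonal of [u], it has 3 non-zeros
    among the 4 vectors of each line directed by [u].  Otherwise let [w] in this
    orthogonal satisfy [h w = 1]: along each plane directed by [u] and [w], up to
    translation, [h] is [c + a ^ 3 + b ^ 3] with [c] equal to 0 or 1, and has 6 or
    10 non-zeros among 16 vectors.  Both cases are averaged over all translates
    of the line or plane. *)
Lemma hermitian_weight v0 : h v0 != 0 -> (96 <= \sum_v (h v != 0%R))%N.
Proof.
set W := (\sum_v _)%N => hv0; have [u hu] : exists u, h u = 1.
  by case: (hermitian_norm01 v0) hv0 => [->|]; [rewrite eqxx | exists v0].
have [/existsP[w /andP[/eqP Buw /eqP hw]]|] :=
    boolP [exists w, (B u w == 0) && (h w == 1)]; last first.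
  rewrite negb_exists => /forallP none.
  have perp w : B u w = 0 -> h w = 0.
    move=> Bw; case: (hermitian_norm01 w) => // hw1.
    by have := none w; rewrite Bw hw1 !eqxx.
  have : (\sum_(a : F) W = \sum_v \sum_(a : F) (h (v + a *: u)%R != 0%R))%N.
    rewrite [RHS]exchange_big; apply: eq_bigr => a _.
    by rewrite (sum_translate (fun v => nat_of_bool (h v != 0))).
  rewrite sum_nat_const hF (eq_bigr (fun=> 3%N)) => [|v _].
    by rewrite sum_nat_const card_mx hF; lia.
  have hv : h v + B u v ^+ 3 = 0.
    have : h (v + B u v ^+ 2 *: u) = 0.
      apply: perp; rewrite hermitianDr hermitianZr -hermitian_diag hu mulr1.
      by rewrite -exprM (expf4 hF) (addf_self hF).
    by rewrite hermitian_norm_line // (addf_self hF) expr0n addr0.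
  under eq_bigr => a _ do rewrite hermitian_norm_line // hv add0r.
  rewrite (sum_translate (fun a => nat_of_bool (a ^+ 3 != 0))).
  by rewrite (sum_cubes (fun x => nat_of_bool (x != 0))) eqxx oner_eq0.
have : (\sum_(a : F) \sum_(b : F) W
    = \sum_v \sum_(a : F) \sum_(b : F) (h (v + a *: u + b *: w)%R != 0%R))%N.
  rewrite [RHS]exchange_big; apply: eq_bigr => a _.
  rewrite [RHS]exchange_big; apply: eq_bigr => b _.
  under eq_bigr do rewrite -addrA.
  by rewrite (sum_translate (fun v => nat_of_bool (h v != 0))).
rewrite !sum_nat_const hF.
suff E v : (6 <= \sum_(a : F) \sum_(b : F) (h (v + a *: u + b *: w)%R != 0%R))%N.
  have : (\sum_(v : vec) 6 <= \sum_v \sum_(a : F) \sum_(b : F)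
     (h (v + a *: u + b *: w)%R != 0%R))%N by apply: leq_sum.
  by rewrite sum_nat_const card_mx hF; lia.
have Bwu : B w u = 0 by rewrite hermitian_sym Buw expr0n.
pose c := h v + B u v ^+ 3 + B w v ^+ 3.
have hE a b : h (v + a *: u + b *: w)
    = c + (a + B u v ^+ 2) ^+ 3 + (b + B w v ^+ 2) ^+ 3.
  rewrite hermitian_norm_line // hermitianDr hermitianZr Bwu mulr0 addr0.
  by rewrite hermitian_norm_line // /c; ring.
have c01 : c = 0 \/ c = 1.
  suff <- : h (v + B u v ^+ 2 *: u + B w v ^+ 2 *: w) = c by exact: hermitian_norm01.
  by rewrite hE !(addf_self hF) expr0n /= !addr0.
under eq_bigr => a _ do under eq_bigr => b _ do rewrite hE.
rewrite (sum_translate (fun a => \sum_(b : F)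
   (c + a ^+ 3 + (b + B w v ^+ 2) ^+ 3 != 0)%R)%N).
under eq_bigr => a _ do rewrite
  (sum_translate (fun b => nat_of_bool (c + a ^+ 3 + b ^+ 3 != 0)))
  (sum_cubes (fun y => nat_of_bool (c + a ^+ 3 + y != 0))).
rewrite (sum_cubes (fun x => ((c + x + 0 != 0)%R + 3 * (c + x + 1 != 0)%R)%N)).
by case: c01 => ->; rewrite ?add0r ?addr0 ?(addf_self hF) ?add0r ?eqxx ?oner_eq0.
Qed.

End Hermitian.

(** * Point sets on which cubic forms sum to zero *)

Section CubicRelations.
Variables (F : finFieldType) (hF : #|F| = 4%N).
Local Notation point := (proj_point F).
Local Notation vec := 'rV[F]_4.
Implicit Types (P Q R X : point) (W : {set point}).

Lemma separating_form P (U : 'M[F]_4) : P \notin linear_set U ->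
  exists2 a : vec, dot (rep P) a != 0
    & forall Q, Q \in linear_set U -> dot (rep Q) a = 0.
Proof.
rewrite in_linear_set submxE => PU.
have [j Pj] : exists j, (rep P *m cokermx U) 0 j != 0.
  apply/existsP; apply: contraR PU; rewrite negb_exists => /forallP H.
  by apply/eqP/rowP=> j; rewrite [RHS]mxE; apply/eqP; have := H j; rewrite negbK.
have E Q : dot (rep Q) (col j (cokermx U))^T = (rep Q *m cokermx U) 0 j.
  by rewrite mxE; apply: eq_bigr => i _; rewrite !mxE.
exists (col j (cokermx U))^T; first by rewrite E.
by move=> Q; rewrite in_linear_set submxE E => /eqP->; rewrite mxE.
Qed.

Definition cubic_relation W :=
  forall a b c, \sum_(P in W) cubic a b c (rep P) = 0.

(** Otherwise a product of three linear forms would vanish at all points of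
    [W] but [P]. *)
Lemma cubic_relation_cover W P (U1 U2 U3 : 'M[F]_4) :
    cubic_relation W -> P \in W ->
    P \notin linear_set U1 -> P \notin linear_set U2 -> P \notin linear_set U3 ->
  ~ (forall Q, Q \in W -> Q != P ->
     [|| Q \in linear_set U1, Q \in linear_set U2 | Q \in linear_set U3]).
Proof.
move=> relW PW /separating_form[a Pa Ua] /separating_form[b Pb Ub].
move=> /separating_form[c Pc Uc] cover; have := relW a b c.
rewrite (bigD1 P) //= big1 => [|Q /andP[QW QP]].
  by rewrite addr0 => /eqP; rewrite !mulf_eq0 (negPf Pa) (negPf Pb) (negPf Pc).
rewrite /cubic; case/or3P: (cover Q QW QP) => [/Ua|/Ub|/Uc] ->;
  by rewrite ?mulr0 ?mul0r.
Qed.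

Lemma in_point P Q : (Q \in linear_set (val P)) = (Q == P).
Proof.
rewrite in_linear_set; apply/idP/eqP => [QP|->]; last by rewrite eqmx_rep.
by apply: rep_inj; rewrite -(eqmx_rep P).
Qed.

Definition join P Q : {set point} := linear_set (val P + val Q)%MS.

Lemma join_l P Q : P \in join P Q.
Proof. by rewrite in_linear_set -eqmx_rep addsmxSl. Qed.

Lemma join_r P Q : Q \in join P Q.
Proof. by rewrite in_linear_set -eqmx_rep addsmxSr. Qed.

Lemma card_join P Q : (#|join P Q| <= 5)%N.
Proof.
have := card_linear_set (val P + val Q)%MS; rewrite hF /=.
have : (\rank (val P + val Q)%MS <= 2)%N.
  by rewrite (leq_trans (mxrank_adds_leqif _ _)) // !rank_point.
move=> r2 cardE; rewrite -(leq_pmul2r (isT : 0 < 3)%N) [X in (X <= _)%N]cardE.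
by move: r2; case: (\rank _) => [|[|[|]]].
Qed.

Lemma cover_seq (A : {set point}) k Q : (#|A| <= k)%N ->
  exists2 s : seq point, size s = k
    & {subset A <= s} /\ forall X, X \in s -> X \in A \/ X = Q.
Proof.
move=> Ak; exists (enum A ++ nseq (k - #|A|) Q).
  by rewrite size_cat size_nseq -cardE subnKC.
split=> X; rewrite mem_cat mem_enum ?mem_nseq; first by move->.
by case/orP=> [|/andP[_ /eqP]]; [left | right].
Qed.

(** A relation between at most 7 points could be cut down to one point by three
    subspaces.  With at most 4 points, single points suffice.  With 6, the only
    other even number, either some line contains three of the points, and it
    leaves out at least one point and at most two others; or no line does, and
    two lines through pairs of points and one point leave out exactly one. *)
Lemma cubic_relation_card W :
  cubic_relation W -> W != set0 -> ~~ odd #|W| -> (8 <= #|W|)%N.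
Proof.
move=> relW /set0Pn[P PW] W2; rewrite ltnNge; apply/negP => W7.
have single X Q : Q != X -> X \notin linear_set (val Q) by rewrite in_point eq_sym.
have WP := cardsD1 P W; rewrite PW add1n in WP.
have [W4|W5] := leqP #|W| 4.
  have [Q QWP] : exists Q, Q \in W :\ P.
    by apply/set0Pn; rewrite -card_gt0; move: W2; rewrite WP; case: #|_|.
  have [|[|a [|b [|c [|]]]] // _ [sub s_in]] := @cover_seq (W :\ P) 3 Q.
    by rewrite -ltnS -WP.
  have ne X : X \in [:: a; b; c] -> X != P.
    by case/s_in=> [|->]; [|move: QWP]; rewrite !inE => /andP[].
  apply: (cubic_relation_cover (U1 := val a) (U2 := val b) (U3 := val c) relW PW);
    try by apply/single/ne; rewrite !inE eqxx ?orbT.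
  by move=> X XW XP; rewrite !in_point; have := sub X; rewrite !inE XP XW; apply.
have W6 : #|W| = 6%N by move: W2 W7 W5; case: #|W| => [|[|[|[|[|[|[|[|]]]]]]]].
have [/existsP[A /existsP[B /existsP[C]]]|noncol] :=
    boolP [exists A, exists B, exists C,
      [&& A \in W, B \in W, C \in W, [&& A != B, A != C & B != C] & A \in join B C]].
  case/and5P=> AW BW CW /and3P[AB AC BC] ABC.
  have W3 : (3 <= #|W :&: join B C|)%N.
    have /card_uniqP E3 : uniq [:: A; B; C] by rewrite /= !inE negb_or AB AC BC.
    apply: leq_trans (eq_leq (esym E3)) _; apply/subset_leq_card/subsetP=> X.
    rewrite mem_seq3 in_setI.
    by case/or3P => /eqP->; rewrite ?AW ?BW ?CW ?ABC ?join_l ?join_r.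
  have [X XW Xj] : exists2 X, X \in W & X \notin join B C.
    by apply/subsetPn/negP => /subset_leq_card; rewrite W6 leqNgt ltnS card_join.
  have [|[|a [|b [|]]] // _ [sub s_in]] := @cover_seq (W :\: join B C :\ X) 2 B.
    rewrite -(leq_add2l 1) -[X in (X + _)%N](_ : (X \in W :\: join B C) = 1%N :> nat).
      rewrite -cardsD1 -(leq_add2l 3); apply: leq_trans (leq_add W3 (leqnn _)) _.
      by rewrite cardsID W6.
    by rewrite in_setD XW Xj.
  have ne Y : Y \in [:: a; b] -> Y != X.
    case/s_in=> [|->]; first by rewrite !inE => /andP[].
    by apply: contraNneq Xj => <-; exact: join_l.
  apply: (cubic_relation_cover (U1 := (val B + val C)%MS) (U2 := val a)
    (U3 := val b) relW XW Xj);
    try by apply/single/ne; rewrite !inE eqxx ?orbT.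
  move=> Y YW YX; rewrite !in_point -/(join B C); have := sub Y.
  rewrite in_setD1 in_setD YX YW mem_seq2.
  by case: (Y \in join B C) => //= /(_ isT).
have sz : size (enum (W :\ P)) = 5%N by rewrite -cardE; move: WP; rewrite W6 => -[].
case E: (enum _) sz (enum_uniq (W :\ P)) => [|a [|b [|c [|d [|e [|]]]]]] // _.
rewrite /= !inE !negb_or => uniq_s.
have in_s X : (X \in W :\ P) = (X \in [:: a; b; c; d; e]) by rewrite -E mem_enum.
have off X Y : X \in W :\ P -> Y \in W :\ P -> X != Y -> P \notin join X Y.
  rewrite 2!in_setD1 => /andP[XP XW] /andP[YP YW] XY; apply: contra noncol => PXY.
  apply/existsP; exists P; apply/existsP; exists X; apply/existsP; exists Y.
  by rewrite PW XW YW PXY ![P == _]eq_sym XP YP XY.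
apply: (cubic_relation_cover (U1 := (val a + val b)%MS) (U2 := (val c + val d)%MS)
   (U3 := val e) relW PW).
- by apply: off; rewrite ?in_s ?inE ?eqxx ?orbT //; case/and5P: uniq_s => /and4P[].
- by apply: off; rewrite ?in_s ?inE ?eqxx ?orbT //; case/and5P: uniq_s => _ _ /andP[].
- apply: single; have : e \in W :\ P by rewrite in_s !inE eqxx !orbT.
  by rewrite !inE => /andP[].
have {}in_s X : X \in W -> X != P -> X \in [:: a; b; c; d; e].
  by rewrite -in_s in_setD1 => -> ->.
move=> X XW XP; rewrite in_point -/(join a b) -/(join c d).
have := in_s X XW XP; rewrite in_cons mem_seq4.
by case/predU1P => [->|/or4P[]/eqP->];
  rewrite ?join_l ?join_r ?eqxx ?orbT.
Qed.

End CubicRelations.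

(** * The minimal norm *)

Section MinimalNorm.
Variables (F : finFieldType) (hF : #|F| = 4%N).
Local Notation point := (proj_point F).
Local Notation n := #|{: point}|.
Local Notation Mdual := {ffun point -> int}.
Implicit Types (P Q : point) (x y z : Mdual) (S T : {set point}).

Definition odd_support x : {set point} := [set P | ~~ (2 %| x P)%Z].

Lemma in_odd_support x P : (P \in odd_support x) = ((x P)%:~R != 0 :> F).
Proof. by rewrite inE -(intf_eq0 hF). Qed.

Lemma int_norm_odd_support x : (#|odd_support x|%:Z <= int_form x x).
Proof.
rewrite -sum_indicator; apply: ler_sum => P _; rewrite inE.
case: (boolP (2 %| x P)%Z) => /= [_|]; first by rewrite -expr2 sqr_ge0.
move: (x P) => z z2; have : z != 0 by apply: contraNneq z2 => ->.
by rewrite -expr2 -sqrf_eq0; have := sqr_ge0 z; lia.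
Qed.

(** Only the differences of planes survive modulo 2, and each is the sum of two
    cubes.  The coefficients are in the prime field, which is what makes the sum
    a Hermitian form. *)
Lemma reduction_hermitian x : M_C x ->
  exists ss, reduction x = ev (hermitian_norm (F := F) ss).
Proof.
pose K (x : Mdual) := exists ss, reduction x = ev (hermitian_norm (F := F) ss).
have K0 y : reduction y = 0 -> K y.
  move=> y0; exists [::]; rewrite y0.
  by apply/rowP=> j; rewrite !mxE /hermitian_norm big_nil.
apply: (@M_C_ind _ K) => [|y|z]; last by apply: K0; rewrite reductionM2.
  split=> [|y z [s ys] [t zt]]; first by apply: K0; rewrite -(mulr0n 0) reductionM2.
  exists (s ++ t); rewrite reductionB ys zt -pfunB; apply: eq_pfun => P.
  by rewrite /hermitian_norm big_cat (oppf_self hF).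
case=> k [S [S' [/andP[k1 k3] Sk Sk' ->]]].
have [k_lt|k_ge] := ltnP k 3.
  by apply: K0; rewrite reductionM2 // oddX subn_eq0 orbF -ltnNge.
have {}k3 : k = 3 by apply/eqP; rewrite eqn_leq k3.
rewrite k3 in Sk Sk' *; have [s _ Ss] := planeP Sk; have [t _ St] := planeP Sk'.
exists [:: s; t]; rewrite mulr1n reductionB !reduction_set_vector Ss St.
rewrite !zero_form_single // -pfunB; apply: eq_pfun => P.
rewrite /hermitian_norm !big_cons big_nil /zero_form /norm_form !dot0r !expr0n /=.
by rewrite !addr0 !mulr1 opprD addrACA subrr add0r (oppf_self hF).
Qed.

Lemma card_odd_support_odd x : M_C x -> odd_support x != set0 ->
  (32 <= #|odd_support x|)%N.
Proof.
move=> /reduction_hermitian[ss xE] /set0Pn[P0 P0x].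
have hE P : (P \in odd_support x) = (hermitian_norm ss (rep P) != 0).
  rewrite in_odd_support; have /rowP/(_ (enum_rank P)) := xE.
  by rewrite !mxE enum_rankK => ->.
rewrite -(leq_pmul2r (isT : 0 < 3)%N).
have := hermitian_weight hF (ss := ss) (v0 := rep P0); rewrite -hE => /(_ P0x).
rewrite (bigD1 0) //= [hermitian_norm ss 0]big1 => [|s _]; last first.
  by rewrite /norm_form dotC dot0r expr0n.
rewrite eqxx add0n => /leq_trans -> //.
have := @sum_points F nat (fun v => nat_of_bool (hermitian_norm ss v != 0)).
rewrite hF => E; rewrite [X in (X <= _)%N]E => [|a v a0]; last first.
  congr (nat_of_bool (_ != 0)); apply: eq_bigr => s _.
  by rewrite /norm_form dotZl exprMn (expf3 hF a) a0 mul1r.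
rewrite -mulr_natr natn leq_mul2r -sum1_card [X in (_ <= X)%N]big_mkcond.
by rewrite /= leq_eqVlt; apply/orP; left; apply/eqP/eq_bigr => P _; rewrite hE; case: ifP.
Qed.

(** These positions support a combination of lines modulo 2, so cubic forms sum
    to zero on them. *)
Lemma card_odd_support_half x : M_C (x *+ 2) -> odd_support x != set0 ->
  (8 <= #|odd_support x|)%N.
Proof.
move=> x2 x0; have H : (reduction (F := F) x = indicator (odd_support x)).
  by apply: eq_pfun => P; rewrite inE (intf_odd hF).
apply: cubic_relation_card => // [a b c|].
  have := code_cubic hF a b c (half_reduction_M_C hF x2); rewrite H => E.
  rewrite -[RHS]E big_mkcond /= -[LHS]sum_enum_val; apply: eq_bigr => j _.
  by rewrite mxE; case: ifP; rewrite ?mul1r ?mul0r.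
have := coord_sum_diff_code hF (isT : 0 < 2)%N.
have /submxP[D DE] := reduction_M_C2 hF x2.
move=> T0; have : coord_sum (indicator (odd_support x)) = 0.
  by rewrite -H /coord_sum DE -mulmxA T0 mulmx0 mxE.
rewrite (coord_sum_indicator hF); case: odd => // /eqP.
by rewrite oner_eq0.
Qed.

Lemma min_int_norm x : M_C x -> x != 0 -> 32 <= int_form x x.
Proof.
move=> Mx x0.
have even_half y : odd_support y = set0 -> exists z, y = z *+ 2.
  move=> y0; exists [ffun P => (y P %/ 2)%Z]; apply/ffunP=> P.
  have : P \notin odd_support y by rewrite y0 inE.
  by rewrite inE negbK => /divzK yP; rewrite ffunMnE ffunE -[RHS]mulr_natr yP.
have [/even_half[y xy]|xodd] := eqVneq (odd_support x) set0; last first.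
  apply: le_trans (int_norm_odd_support x).
  by rewrite lez_nat card_odd_support_odd.
rewrite xy int_formMl int_formMr -mulrA.
have [/even_half[z yz]|yodd] := eqVneq (odd_support y) set0; last first.
  have := int_norm_odd_support y; have : (8 <= #|odd_support y|)%N.
    by apply: card_odd_support_half; rewrite -?xy.
  lia.
rewrite yz int_formMl int_formMr.
have z_even : (2 %| \sum_P z P)%Z.
  have := dvd8_sum_M_C hF Mx; rewrite xy yz.
  under eq_bigr do rewrite -mulrnA ffunMnE.
  rewrite sumrMnl -[X in (_ %| X)%Z]mulr_natr => /dvdzP[q E].
  by apply/dvdzP; exists q; apply: (@mulIf _ (4 : int)) => //; rewrite E; ring.
have : (2 %| int_form z z)%Z.
  rewrite -[X in (_ %| X)%Z](subrK (\sum_P z P)) rpredD // -sumrB.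
  apply: rpred_sum => P _; rewrite -(intf_eq0 hF) rmorphB rmorphM /= (intf_odd hF).
  by case: (2 %| z P)%Z; rewrite ?mulr0 ?mulr1 subrr.
have : 0 < int_form z z.
  rewrite lt_neqAle sumr_ge0 ?andbT => [|P _]; last by rewrite -expr2 sqr_ge0.
  apply: contra_neq x0 => /esym/eqP; rewrite psumr_eq0 => [|P _]; last first.
    by rewrite -expr2 sqr_ge0.
  move=> /allP z0; rewrite xy yz; apply/ffunP=> P; rewrite !ffunMnE ffunE.
  have /= := z0 P (mem_index_enum P); rewrite -expr2 sqrf_eq0 => /eqP->.
  by rewrite !mul0rn.
lia.
Qed.

End MinimalNorm.

(** * Conclusion *)

Section Conclusion.
Variables (F : finFieldType) (hF : #|F| = 4%N).
Local Notation point := (proj_point F).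
Local Notation n := #|{: point}|.
Local Notation Mdual := {ffun point -> int}.
Implicit Types (P Q : point) (x y z : Mdual).

(** Stated for a variable base, so that no power is evaluated. *)
Lemma power_quotient (z : int) : z != 0 ->
  (z ^+ 190)%:~R / (z%:~R ^+ 2) ^+ 85 = z%:~R ^+ 20 :> rat.
Proof.
move=> z0; rewrite rmorphXn -exprM -[190%N]/(20 + 2 * 85)%N exprD mulfK //.
by rewrite expf_neq0 // intr_eq0.
Qed.

Lemma M_C_has_rank_discriminant : has_rank (@M_C F) 85 /\
  has_discriminant (@dual_form F) (@M_C F) (2 ^+ 20).
Proof.
have [B [HB detB]] := M_C_basis_matrix hF.
have B0 : \det B != 0 by rewrite -sqrf_eq0 detB expf_neq0.
have [] := discriminant_from_matrix HB B0; rewrite detB (card_points hF) => rk disc.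
split; first exact: rk.
have four : 4 = 2%:~R ^+ 2 :> rat by [].
rewrite four power_quotient in disc; last by [].
exact: disc.
Qed.

Lemma M_C_norm_ge8 x : M_C x -> x != 0 -> 8 <= dual_form x x.
Proof.
move=> Mx x0; rewrite dual_formE ler_pdivlMr //.
have := min_int_norm hF Mx x0; rewrite -(ler_int rat); apply: le_trans.
by [].
Qed.

Lemma M_C_min_attained : exists x, [/\ M_C x, x != 0 & @dual_form F x x = 8].
Proof.
have [P [Q PQ]] : exists P Q : point, P != Q.
  have : (1 < #|{: point}|)%N by rewrite (card_points hF).
  by case/card_gt1P=> P [Q [_ _ PQ]]; exists P, Q.
pose x : Mdual := (set_vector [set P] - set_vector [set Q]) *+ 2 ^ 2.
have Mx : M_C x by apply: M_C_diff => //; exact: point_subspace.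
have xx : int_form x x = 32.
  rewrite int_formMl int_formMr int_formBl !int_formBr !int_form_set !setIid.
  have PQ0 : [set P] :&: [set Q] = set0.
    by apply/setP=> X; rewrite !inE; case: eqP => // ->; rewrite (negPf PQ).
  by rewrite (setIC [set Q]) PQ0 !cards1 cards0.
exists x; split=> //; last by rewrite dual_formE xx.
by apply: contra_eq_neq xx => ->; rewrite -(mulr0n 0) int_formMl mulr0.
Qed.

End Conclusion.

Theorem theorem6p1 (F : finFieldType) (hF : #|F| = 4%N) :
  [/\ is_lattice (@dual_form F) (@M_C F),
      is_even (@dual_form F) (@M_C F) /\ positive_definite (@dual_form F) (@M_C F),
      has_rank (@M_C F) 85,
      has_discriminant (@dual_form F) (@M_C F) (2 ^+ 20)
    & has_minimal_norm (@dual_form F) (@M_C F) 8].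
Proof.
have [rk disc] := M_C_has_rank_discriminant hF.
have posdef : positive_definite (@dual_form F) (@M_C F).
  by move=> x Mx x0; apply: lt_le_trans (M_C_norm_ge8 hF Mx x0).
split=> //.
- split.
  + exact: M_C_submodule.
  + by exists 85%N.
  + by move=> x y _ _; rewrite !dual_formE int_formC.
  + move=> x y z _ _ _; rewrite !dual_formE -mulrDl -rmorphD; congr (_%:~R / _).
    by rewrite -[y]opprK int_formBl -[in RHS]sub0r int_formBl -(mulr0n 0) int_formMl; ring.
  + move=> x y Mx My; have /dvdzP[q qE] := int_form_M_C hF Mx My.
    by rewrite dual_formE qE rmorphM /= mulfK // intr_int.
  + move=> x Mx x0; apply/eqP; apply: contraT => xn0.
    by have := posdef x Mx xn0; rewrite x0 // ltxx.
- split=> // x Mx; have /dvdzP[q qE] := int_norm_M_C hF Mx.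
  by exists q; rewrite dual_formE qE !rmorphM /=; field.
- by split; [exact: M_C_min_attained | exact: M_C_norm_ge8].
Qed.
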